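(* Let $0<\varepsilon<1$, $C>0$ and $\alpha>0$ be constants. Let $p$ be an odd prime, possibly depending on $n$. Suppose $\mu$ is an $\alpha$-balanced random variable taking values in $\mathbb{Z}/p\mathbb{Z}$ and $\mathbf{w}=(w_1,\dots,w_n)\in(\mathbb{Z}/p\mathbb{Z})^n$ is such that $$\rho=\rho(\mathbf{w})=\sup_{a\in\mathbb{Z}/p\mathbb{Z}}\Big|\mathbf{P}(\mu_1w_1+\dots+\mu_nw_n=a)-\frac1p\Big|=\Theta(n^{-C}),$$ where $\mu_1,\dots,\mu_n$ are iid copies of $\mu$. Then for any $n^{\varepsilon/2}\le n'\le n$ there is a set $W'$ of $n-n'$ of the components $w_i$ such that one of the following holds: - $p\lesssim n^{C}$, and there exists a GAP $Q\subset\mathbb{Z}/p\mathbb{Z}$ of rank one that contains $W'$, with $$|Q|\le O_{C,\varepsilon}\big(1+p\sqrt{(\log n)/n'}\big);$$ - $p\gtrsim n^{C}$, and there exists a proper symmetric GAP $Q\subset\mathbb{Z}/p\mathbb{Z}$ of rank $r=O_{C,\varepsilon}(1)$ that contains $W'$, with $$|Q|=O_{C,\varepsilon}\big(1+\rho^{-1}/{n'}^{r/2}\big).$$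
   Context: A random variable $\mu$ in $\mathbb{Z}/p\mathbb{Z}$ is $\alpha$-balanced if $\max_a\mathbf{P}(\mu=a)\le1-\alpha$. A generalized arithmetic progression (GAP) of rank $r$ in an abelian group $G$ is a set of the form $Q=\{a_0+x_1a_1+\dots+x_ra_r: M_i\le x_i\le M_i',\ x_i\in\mathbb{Z},\ 1\le i\le r\}$ for some $a_0,\dots,a_r\in G$ and integers $M_i,M_i'$. It is proper (for this presentation) if the map $(x_1,\dots,x_r)\mapsto a_0+x_1a_1+\dots+x_ra_r$ is injective on the integer box $\prod_i[M_i,M_i']$, and symmetric if $a_0=0$ and $M_i=-M_i'$ for all $i\ge1$. The components $w_i$ are counted with multiplicity (i.e. $W'$ corresponds to a set of $n-n'$ indices). $X\lesssim Y$ (equivalently $Y\gtrsim X$) means $|X|\le KY$ for a fixed constant $K$; the constant $\alpha$ is fixed and implied constants may depend on it. *)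

(* Defs.v *)
From HB Require Import structures.
From mathcomp Require Import all_boot all_order all_algebra.
From mathcomp Require Import all_classical all_reals all_analysis.

Set Implicit Arguments.
Unset Strict Implicit.
Unset Printing Implicit Defensive.

Import Order.TTheory GRing.Theory Num.Theory.
Import numFieldNormedType.Exports.

Local Open Scope classical_set_scope.
Local Open Scope ring_scope.

(* The discrete sigma-algebra on 'I_n.+1; 'F_p inherits it by conversion. *)
HB.instance Definition _ (n : nat) := isPointed.Build 'I_n.+1 ord0.
HB.instance Definition _ (n : nat) := @isMeasurable.Build
  default_measure_display 'I_n.+1 (@discrete_measurable 'I_n.+1)
  (@discrete_measurable0 _) (@discrete_measurableC _)
  (@discrete_measurableU _).

Section Probability.
Context {R : realType} {d d' d0 : measure_display}
  {T : measurableType d} {T0 : measurableType d0} {T' : measurableType d'}.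

(* The product rule over all of I gives it over every subfamily, by taking
   the other A i to be setT. *)
Definition mutually_independent (P : probability T R) (I : finType)
    (X : I -> {RV P >-> T'}) : Prop :=
  forall A : I -> set T', (forall i, measurable (A i)) ->
    P (\bigcap_(i in [set: I]) (X i @^-1` A i)) =
    (\prod_(i : I) P (X i @^-1` A i))%E.

Definition same_distribution (P : probability T R) (X : {RV P >-> T'})
    (P0 : probability T0 R) (Y : {RV P0 >-> T'}) : Prop :=
  forall A : set T', measurable A -> distribution P X A = distribution P0 Y A.

Definition iid_copies (P : probability T R) (I : finType)
    (X : I -> {RV P >-> T'}) (P0 : probability T0 R) (Y : {RV P0 >-> T'}) :
    Prop :=
  mutually_independent X /\ forall i, same_distribution (X i) Y.

End Probability.

Definition alpha_balanced (R : realType) (p : nat) (alpha : R)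
    (d : measure_display) (T : measurableType d) (P : probability T R)
    (mu : {RV P >-> 'F_p}) : Prop :=
  forall a : 'F_p, fine (P [set t | mu t = a]) <= 1 - alpha.

Definition rho (R : realType) (p n : nat)
    (d : measure_display) (T : measurableType d) (P : probability T R)
    (X : 'I_n -> {RV P >-> 'F_p}) (w : 'I_n -> 'F_p) : R :=
  sup (range (fun a : 'F_p =>
    `| fine (P [set t | \sum_(i < n) X i t * w i = a]) - p%:R^-1 |)).

(* A GAP together with a presentation; properness and symmetry refer to it. *)
Record gap (G : zmodType) (r : nat) := Gap {
  gap_base : G;
  gap_gen : 'I_r -> G;
  gap_lo : 'I_r -> int;
  gap_hi : 'I_r -> int }.

Section Gap.
Context {G : zmodType} {r : nat}.
Implicit Type q : gap G r.

Definition gap_box q : set ('I_r -> int) :=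
  [set x | forall i, gap_lo q i <= x i <= gap_hi q i].

Definition gap_map q (x : 'I_r -> int) : G :=
  gap_base q + \sum_(i < r) gap_gen q i *~ x i.

Definition gap_set q : set G := gap_map q @` gap_box q.

Definition gap_proper q : Prop := {in gap_box q &, injective (gap_map q)}.

Definition gap_symmetric q : Prop :=
  gap_base q = 0 /\ forall i, gap_lo q i = - gap_hi q i.

End Gap.

(* Main.v *)
(* By Fourier inversion and convexity, rho is at most the average over xi <> 0 of
   exp(-(alpha/2) g(xi)), where g(xi) = sum_i phi(w_i xi) and
   phi(x) = 1 - cos(2 pi x / p).  A single xi with g(xi) = O(log n) puts all but
   n' of the w_i in a dilated interval; this settles the case p = O(n^C).
   If p is larger, dyadic pigeonholing gives m such that S = {g <= m + 1} has
   at least c rho p exp(alpha m / 4) elements.  All but n' of the w_i lie in the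
   set X of those x whose average of phi(x xi) over xi in S is at most
   (m + 1) / n', and k X has at most 4 p / |S| elements for k = 2^s of order
   sqrt(n' / (m + 1)).  So k X grows polynomially in k, which yields j of order k
   such that j X is almost invariant under X, and the large spectrum of j X
   consists of frequencies nearly annihilating X.  The corresponding linear
   forms, lifted to integer-valued forms on formal combinations of residues,
   have a reduced basis, and its images in Z/pZ generate the progression;
   counting a box of such combinations bounds both the rank and the size. *)
Require Import Defs.
From HB Require Import structures.
From mathcomp Require Import all_boot all_order all_algebra.
From mathcomp Require Import complex.
From mathcomp Require Import zify ring lra.
From mathcomp Require Import all_classical all_reals all_analysis.

Set Implicit Arguments.
Unset Strict Implicit.
Unset Printing Implicit Defensive.

Import Order.TTheory GRing.Theory Num.Theory.
Import numFieldNormedType.Exports.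

Local Open Scope ring_scope.

(** Rank and size come from one volume count. Let $h$ be of order $k$. A vector of the reduced basis
    has two natural ranges: with at most $H_i$ multiples all forms stay well below $p$, so that
    residues still determine the forms; with at most $J_i$ multiples one already reaches $X$. Both
    ranges are inversely proportional to the norm of the vector, so $J_i h\lesssim H_i+1$, while the
    box with half-sides $H_i$ has $\lesssim p/|\mathrm{Spec}|\lesssim|kX|$ points, $\mathrm{Spec}$
    being the large spectrum. Passing from $H$ to $J$ saves $h^r$, the source of $n'^{-r/2}$. Each
    $H_i+1$ is also $\gtrsim h$, so a rank above the growth exponent $g$ of $|kX|$ would overfill
    the box. Hence the basis is built one short vector at a time, with a budget of $g+1$ vectors,
    and constants depending on the budget are harmless; no theorem on successive minima enters.
    Since $k^2$ is of order $n'/(m+1)$ rather than $n'$, powers of $m+1$ are lost; the factor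
    $\exp(\alpha m/4)$ in the size of the level set pays for them. *)

Definition supnorm (V : zmodType) (I : finType) (L : I -> {additive V -> int})
  (v : V) : nat := (\max_(i : I) `|L i v|)%N.

(** * Finite families of integer forms and reduced bases *)

Section SupNorm.
Variables (V : zmodType) (I : finType) (L : I -> {additive V -> int}).

Lemma supnorm_ge i v : (`|L i v| <= supnorm L v)%N.
Proof. exact: (leq_bigmax i). Qed.

Lemma supnorm_leP m v :
  reflect (forall i, `|L i v| <= m)%N (supnorm L v <= m)%N.
Proof.
apply: (iffP idP) => [/bigmax_leqP H i|H]; first exact: H.
by apply/bigmax_leqP => i _; apply: H.
Qed.

Lemma supnorm_eq0P v : reflect (forall i, L i v = 0) (supnorm L v == 0%N).
Proof.
rewrite -leqn0; apply: (iffP (supnorm_leP _ _)) => H i; last by rewrite H.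
by apply/eqP; rewrite -absz_eq0 -leqn0 H.
Qed.

Lemma supnormD u v : (supnorm L (u + v) <= supnorm L u + supnorm L v)%N.
Proof.
apply/supnorm_leP => i; rewrite raddfD.
by have := supnorm_ge i u; have := supnorm_ge i v; lia.
Qed.

Lemma supnormMz v (t : int) : supnorm L (v *~ t) = (`|t| * supnorm L v)%N.
Proof.
have h i : `|L i (v *~ t)|%N = (`|t| * `|L i v|)%N.
  by rewrite raddfMz -mulrzr intz abszM mulnC.
rewrite /supnorm (eq_bigr _ (fun i _ => h i)).
apply: (big_rec2 (fun x y => x = `|t| * y)%N); first by rewrite muln0.
by move=> i x y _ ->; rewrite maxnMr.
Qed.

Lemma supnormB u v : (supnorm L (u - v) <= supnorm L u + supnorm L v)%N.
Proof.
apply: leq_trans (supnormD _ _) _.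
by rewrite -[- v]mulrN1z supnormMz mul1n.
Qed.

Lemma supnorm_sum (J : finType) (f : J -> V) :
  (supnorm L (\sum_j f j) <= \sum_j supnorm L (f j))%N.
Proof.
elim/big_rec2: _ => [|j y x _ h].
  by apply/supnorm_leP => i; rewrite raddf0.
by apply: leq_trans (supnormD _ _) _; rewrite leq_add2l.
Qed.

Lemma supnorm_attained v : (0 < supnorm L v)%N ->
  exists i, supnorm L v = `|L i v|%N.
Proof.
move=> h.
have I0 : (0 < #|I|)%N.
  rewrite lt0n; apply/negP => /eqP I0; move: h; rewrite /supnorm big_pred0 // => i.
  by have := card0_eq I0 i; rewrite inE.
by have [i hi] := bigop.eq_bigmax (fun i => `|L i v|%N) I0; exists i.
Qed.

End SupNorm.

Lemma int_round (a q : int) : q != 0 ->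
  exists t : int, (2 * `|(a - q * t)%R| <= `|q|)%N.
Proof.
move=> q0.
have h1 := divz_eq a q; have h2 := modz_ge0 a q0; have h3 := ltz_mod a q0.
have [h|h] := leqP (2 * `|(a %% q)%Z|)%N `|q|%N.
  by exists (a %/ q)%Z; rewrite {1}h1 mulrC addrAC subrr add0r.
case: (ltrP 0 q) => hq.
  exists ((a %/ q)%Z + 1).
  have -> : a - q * ((a %/ q)%Z + 1) = (a %% q)%Z - q.
    by rewrite {1}h1; ring.
  lia.
exists ((a %/ q)%Z - 1).
have -> : a - q * ((a %/ q)%Z - 1) = (a %% q)%Z + q.
  by rewrite {1}h1; ring.
lia.
Qed.

(** The recursion is the cost of undoing one projection: the multiple of the shortest vector is what
    is left of [x] after subtracting fewer than [k] terms, each of norm at most [4 * cover_const k']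
    times that of [x]. *)
Fixpoint cover_const (k : nat) : nat :=
  if k is k'.+1 then (1 + 4 * k * cover_const k')%N else 0%N.

(* One projects along a shortest vector [b], cleared of denominators so that
   the forms stay integral, and recurses on the projected forms. *)
Lemma short_basis (V : zmodType) (I : finType) k :
  forall (L : I -> {additive V -> int}) (X : V -> Prop) (D : nat),
  (forall x, X x -> supnorm L x <= D)%N ->
  exists r (b : 'I_r -> V), [/\ (r <= k)%N,
    forall n : 'I_r -> int,
      supnorm L (\sum_i b i *~ n i) = 0%N -> forall i, n i = 0,
    forall i, (supnorm L (b i) <= 4 ^ k * D)%N &
    (r < k)%N -> forall x, X x -> exists n : 'I_r -> int,
      supnorm L (x - \sum_i b i *~ n i) = 0%N /\
      forall i, (`|n i| * supnorm L (b i) <= cover_const k * supnorm L x)%N].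
Proof.
elim: k => [|k IH] L X D XD.
  by exists 0%N, (fun _ => 0); split=> // [n _|] [].
have [X0|] := pselect (forall x, X x -> supnorm L x = 0%N).
  exists 0%N, (fun _ => 0); split=> // [n _ []|[]|_ x Xx] //.
  by exists (fun _ => 0); rewrite big_ord0 subr0 X0 //; split => // -[].
move=> /existsNP[x0 /not_implyP[Xx0 x0n]].
(* The minimum runs over all of [V], not only over [X]: any combination of norm below [q] must then
   have norm zero. *)
have exm : exists m, `[< exists v, supnorm L v = m /\ (0 < m)%N >].
  by exists (supnorm L x0); apply/asboolP; exists x0; split => //; lia.
case: (ex_minnP exm) => q /asboolP[b [bq q0]] qmin'.
have qmin v : (supnorm L v < q)%N -> supnorm L v = 0%N.
  move=> h; apply/eqP; apply/negPn/negP => v0.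
  suff : (q <= supnorm L v)%N by rewrite leqNgt h.
  by apply: qmin'; apply/asboolP; exists v; split => //; rewrite lt0n.
have qD : (q <= D)%N.
  apply: leq_trans (XD _ Xx0); apply: contra_notT x0n; rewrite -ltnNge.
  exact: qmin.
have [i1 bi1] : exists i, supnorm L b = `|L i b|%N.
  by apply: supnorm_attained; rewrite bq.
set c1 := L i1 b; rewrite bq in bi1.
have c10 : c1 != 0 by rewrite -absz_eq0 /c1 -bi1 -lt0n.
pose L' i : {additive V -> int} :=
  (c1 \*o L i) \- (L i b \*o L i1).
have L'E i v : L' i v = c1 * L i v - L i b * L i1 v by [].
have L'b i : L' i b = 0 by rewrite L'E /c1; ring.
have Lib i : (`|L i b| <= q)%N by rewrite -bq; apply: supnorm_ge.
have L'le v : (supnorm L' v <= 2 * q * supnorm L v)%N.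
  apply/supnorm_leP => i; rewrite L'E.
  have := supnorm_ge L i v; have := supnorm_ge L i1 v; have := Lib i.
  move: (L i v) (L i1 v) (L i b) (supnorm L v) => a a1 z m h1 h2 h3.
  have : (`|(c1 * a)%R| = q * `|a|)%N by rewrite abszM -bi1.
  have : (`|(z * a1)%R| <= q * m)%N by rewrite abszM; apply: leq_mul.
  have : (q * `|a| <= q * m)%N by rewrite leq_mul2l h3 orbT.
  rewrite -mulnA; lia.
have [|r [b' [rk ind bD cov]]] := IH L' X (2 * q * D)%N.
  by move=> x /XD xD; apply: leq_trans (L'le _) _; rewrite leq_mul2l xD orbT.
(* Size reduction: subtracting a multiple of [b] leaves [L'] unchanged and brings the form [i1] down
   to at most [q / 2]. *)
have ht i : exists t, (2 * `|(L i1 (b' i) - c1 * t)%R| <= q)%N.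
  by have [t] := int_round (L i1 (b' i)) c10; rewrite -bi1; exists t.
pose t i := projT1 (cid (ht i)).
pose c i := b' i - b *~ t i.
have L1z v (z : int) : L i1 (v - b *~ z) = L i1 v - c1 * z.
  by rewrite raddfB raddfMz -mulrzr intz.
have tP i : (2 * `|L i1 (c i)| <= q)%N.
  by rewrite /c L1z; apply: (projT2 (cid (ht i))).
have L'bz j v (z : int) : L' j (v - b *~ z) = L' j v.
  by rewrite raddfB raddfMz L'b mul0rz subr0.
have L'c j i : L' j (c i) = L' j (b' i) by rewrite L'bz.
have nL'c i : supnorm L' (c i) = supnorm L' (b' i).
  by apply: eq_bigr => j _; rewrite L'c.
have b'0 i : (0 < supnorm L' (b' i))%N.
  rewrite lt0n; apply/negP => h.
  have := ind (fun j => (j == i)%:R).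
  have -> : \sum_(i0 < r) b' i0 *~ (i0 == i)%:R = b' i.
    rewrite (bigD1 i) //= eqxx big1 ?addr0 // => j /negPf ->.
    by rewrite mulr0z.
  by move=> /(_ (eqP h) i); rewrite eqxx.
(* As [L'] does not vanish at [c i], its norm is at least [q]. The error [q * q / 2] left by the
   size reduction is therefore at most half of [q * supnorm L (c i)] and is absorbed, at the price
   of the factor 2. *)
have nLc i : (q * supnorm L (c i) <= 2 * supnorm L' (b' i))%N.
  have cq : (q <= supnorm L (c i))%N.
    rewrite leqNgt; apply/negP => /qmin c0.
    by have := L'le (c i); rewrite c0 nL'c muln0; have := b'0 i; lia.
  have : (2 * (q * supnorm L (c i)) <= 2 * supnorm L' (b' i) + q * q)%N.
    have [j ->] : exists j, supnorm L (c i) = `|L j (c i)|%N.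
      by apply: supnorm_attained; lia.
    have h := L'E j (c i).
    have {}h : c1 * L j (c i) = L' j (c i) + L j b * L i1 (c i).
      by rewrite h; ring.
    have h1 : (q * `|L j (c i)| = `|(c1 * L j (c i))%R|)%N by rewrite abszM -bi1.
    have h2 := supnorm_ge L' j (c i); rewrite nL'c in h2.
    have h3 : (2 * `|(L j b * L i1 (c i))%R| <= q * q)%N.
      by rewrite abszM mulnCA leq_mul.
    rewrite h1 h; lia.
  nia.
pose B (i : 'I_r.+1) := if unlift ord0 i is Some j then c j else b.
have B0 : B ord0 = b by rewrite /B unlift_none.
have BS j : B (lift ord0 j) = c j by rewrite /B liftK.
have sumB (n : 'I_r.+1 -> int) :
    \sum_i B i *~ n i = b *~ n ord0 + \sum_j c j *~ n (lift ord0 j).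
  by rewrite big_ord_recl B0; congr (_ + _); apply: eq_bigr => j _; rewrite BS.
have L'sum (n : 'I_r -> int) j :
    L' j (\sum_i c i *~ n i) = L' j (\sum_i b' i *~ n i).
  rewrite !raddf_sum; apply: eq_bigr => i _.
  by rewrite !raddfMz [in LHS]L'c.
exists r.+1, B; split.
- by [].
- move=> n; rewrite sumB => n0.
  have nS j : n (lift ord0 j) = 0.
    apply: (ind (fun j => n (lift ord0 j))).
    apply/eqP/supnorm_eq0P => i; rewrite -L'sum.
    have := L'le (b *~ n ord0 + \sum_j0 c j0 *~ n (lift ord0 j0)).
    rewrite n0 muln0 leqn0 => /supnorm_eq0P/(_ i).
    by rewrite raddfD raddfMz L'b mul0rz add0r.
  move: n0; rewrite big1 ?addr0 => [|j _]; last by rewrite nS.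
  rewrite supnormMz bq => /eqP; rewrite muln_eq0 => n0 i.
  case: (unliftP ord0 i) => [j ->|->]; first exact: nS.
  by apply/eqP; move: n0; rewrite absz_eq0 => /orP[//|]; rewrite -[_ == _]negbK -lt0n q0.
- move=> i; case: (unliftP ord0 i) => [j ->|->].
    rewrite BS; have h1 := nLc j; have h2 := bD j.
    have : (q * supnorm L (c j) <= q * (4 ^ k.+1 * D))%N.
      apply: (leq_trans h1); rewrite expnS; move: h2; nia.
    by rewrite leq_mul2l; have -> : (q == 0)%N = false by lia.
  rewrite B0 bq; apply: leq_trans qD _.
  by rewrite leq_pmull // expn_gt0.
move=> rk1 x Xx.
have [n [n0 nb]] := cov rk1 x Xx.
pose u := x - \sum_i c i *~ n i.
have L'u j : L' j u = 0.
  move/eqP/supnorm_eq0P: n0 => /(_ j).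
  by rewrite /u (raddfB (L' j)) => <-; rewrite (raddfB (L' j)) L'sum.
have [z] := int_round (L i1 u) c10; rewrite -L1z -bi1.
set w := u - _ => wq.
have L'w j : L' j w = 0 by rewrite L'bz.
(* All [L'] vanish at [w], so its forms are those of [b] scaled by a ratio of modulus at most 1/2;
   minimality of [q] does the rest. *)
have w0 : supnorm L w = 0%N.
  apply: qmin.
  have : (2 * supnorm L w <= q)%N.
    rewrite mulnC -leq_divRL //; apply/supnorm_leP => j; rewrite leq_divRL // mulnC.
    have h := L'E j w; rewrite L'w in h.
    have h1 : c1 * L j w = L j b * L i1 w by move: h => /esym/eqP; rewrite subr_eq0 => /eqP.
    have : (q * (2 * `|L j w|) <= q * q)%N.
      have -> : (q * (2 * `|L j w|) = 2 * `|(c1 * L j w)%R|)%N.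
        by rewrite abszM -bi1; lia.
      by rewrite h1 abszM mulnCA leq_mul.
    by rewrite leq_mul2l; have -> : (q == 0)%N = false by lia.
  lia.
have nc i : (`|n i| * supnorm L (c i) <= 4 * cover_const k * supnorm L x)%N.
  have h1 := nb i; have h2 := L'le x; have h3 := nLc i.
  have : (q * (`|n i| * supnorm L (c i)) <= q * (4 * cover_const k * supnorm L x))%N.
    have h4 : (`|n i| * (q * supnorm L (c i)) <= `|n i| * (2 * supnorm L' (b' i)))%N.
      by rewrite leq_mul2l h3 orbT.
    have h5 : (cover_const k * supnorm L' x <= cover_const k * (2 * q * supnorm L x))%N.
      by rewrite leq_mul2l h2 orbT.
    lia.
  by rewrite leq_mul2l; have -> : (q == 0)%N = false by lia.
pose m (i : 'I_r.+1) := if unlift ord0 i is Some j then n j else z.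
have m0 : m ord0 = z by rewrite /m unlift_none.
have mS j : m (lift ord0 j) = n j by rewrite /m liftK.
exists m.
have -> : x - \sum_i B i *~ m i = w.
  have -> : \sum_i B i *~ m i = b *~ z + \sum_j c j *~ n j.
    by rewrite sumB m0; congr (_ + _); apply: eq_bigr => j _; rewrite mS.
  by rewrite /w /u opprD addrCA addrC.
split => // i; case: (unliftP ord0 i) => [j ->|->].
  by rewrite mS BS; apply: leq_trans (nc j) _; rewrite /= leq_mul2r; apply/orP; right; nia.
rewrite m0 B0 -supnormMz.
have -> : b *~ z = u - w by rewrite /w opprB addrC subrK.
apply: leq_trans (supnormB _ _ _) _; rewrite w0 addn0.
apply: leq_trans (supnormB _ _ _) _.
have : (supnorm L (\sum_i c i *~ n i) <= r * (4 * cover_const k * supnorm L x))%N.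
  apply: leq_trans (supnorm_sum _ _) _.
  apply: (@leq_trans (\sum_(i < r) (4 * cover_const k * supnorm L x))%N).
    by apply: leq_sum => j _; rewrite supnormMz.
  by rewrite sum_nat_const card_ord.
have : (r * (4 * cover_const k * supnorm L x) <= k.+1 * (4 * cover_const k * supnorm L x))%N.
  by rewrite leq_mul2r; apply/orP; right; lia.
rewrite /=; lia.
Qed.

(** * Iterated sumsets: covering, doubling and growth *)

Section Sumsets.
Import mathcomp.boot.fintype mathcomp.boot.finset.
Local Open Scope set_scope.
Local Open Scope ring_scope.
Variable G : finZmodType.
Implicit Types (A B T X : {set G}) (x y z : G) (k m : nat).

Definition sumset A B : {set G} := [set z.1 + z.2 | z in setX A B]%SET.

Lemma sumsetP A B x :
  reflect (exists y z, [/\ y \in A, z \in B & x = y + z]) (x \in sumset A B).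
Proof.
apply: (iffP imsetP) => [[[y z]]|[y [z [yA zB ->]]]].
  by rewrite inE => /andP[/= yA zB] ->; exists y, z.
by exists (y, z) => //; rewrite inE yA zB.
Qed.

Lemma mem_sumset A B x y : x \in A -> y \in B -> x + y \in sumset A B.
Proof. by move=> xA yB; apply/sumsetP; exists x, y. Qed.

Lemma card_sumset_le A B : (#|sumset A B| <= #|A| * #|B|)%N.
Proof. by rewrite -cardsX leq_imset_card. Qed.

Definition nsum k A : {set G} := iter k (sumset A) [set 0]%SET.
Arguments nsum : simpl never.

Lemma nsumS k A : nsum k.+1 A = sumset A (nsum k A). Proof. by []. Qed.

Lemma nsum0P A x : (x \in nsum 0 A) = (x == 0).
Proof. by rewrite inE. Qed.

Lemma nsumSP k A x :
  reflect (exists y z, [/\ y \in A, z \in nsum k A & x = y + z])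
    (x \in nsum k.+1 A).
Proof. exact: sumsetP. Qed.

Lemma nsum1 A : nsum 1 A = A.
Proof.
apply/setP => x; apply/nsumSP/idP => [[y [z [yA]]]|xA].
  by rewrite nsum0P => /eqP -> ->; rewrite addr0.
by exists x, 0; rewrite nsum0P eqxx addr0.
Qed.

Lemma nsumD a b A : nsum (a + b) A = sumset (nsum a A) (nsum b A).
Proof.
elim: a => [|a IH].
  apply/setP => x; apply/idP/sumsetP => [xb|[y [z []]]].
    by exists 0, x; rewrite nsum0P eqxx add0r.
  by rewrite nsum0P => /eqP -> zb ->; rewrite add0r.
rewrite addSn nsumS IH; apply/setP => x; apply/sumsetP/sumsetP.
  move=> [y [_ [yA /sumsetP[z [t [za tb ->]]] ->]]].
  by exists (y + z), t; rewrite addrA mem_sumset.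
move=> [_ [t [/nsumSP[y [z [yA za ->]]] tb ->]]].
by exists y, (z + t); rewrite addrA mem_sumset.
Qed.

Lemma mem_nsumD a b A x y :
  x \in nsum a A -> y \in nsum b A -> x + y \in nsum (a + b) A.
Proof. by rewrite nsumD; apply: mem_sumset. Qed.

Lemma nsum_mul a b A : nsum (a * b) A = nsum a (nsum b A).
Proof. by elim: a => // a IH; rewrite mulSn nsumD IH. Qed.

Lemma mem_nsum_0 k A : 0 \in A -> 0 \in nsum k A.
Proof.
move=> A0; elim: k => [|k IH]; first by rewrite nsum0P.
by apply/nsumSP; exists 0, 0; rewrite addr0.
Qed.

Lemma nsum_mono a b A : 0 \in A -> (a <= b)%N -> nsum a A \subset nsum b A.
Proof.
move=> A0 /subnK <-; apply/subsetP => x xa; rewrite -[x]add0r.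
by apply: mem_nsumD => //; apply: mem_nsum_0.
Qed.

Lemma card_nsum_mono a b A :
  0 \in A -> (a <= b)%N -> (#|nsum a A| <= #|nsum b A|)%N.
Proof. by move=> A0 ab; apply/subset_leq_card/nsum_mono. Qed.

Lemma card_nsum_gt0 k A : 0 \in A -> (0 < #|nsum k A|)%N.
Proof. by move=> A0; apply/card_gt0P; exists 0; apply: mem_nsum_0. Qed.

Definition symmetric_set A := forall x, x \in A -> - x \in A.

Lemma nsum_sym k A : symmetric_set A -> symmetric_set (nsum k A).
Proof.
move=> As; elim: k => [|k IH] x.
  by rewrite !nsum0P oppr_eq0.
by move=> /nsumSP[y [z [yA za ->]]]; rewrite opprD; apply: mem_sumset; auto.
Qed.

Lemma mem_nsumMn k A x : x \in A -> x *+ k \in nsum k A.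
Proof.
move=> xA; elim: k => [|k IH]; first by rewrite nsum0P.
by rewrite mulrS mem_sumset.
Qed.

Lemma mem_nsum_sum (I : finType) (f : I -> G) (n : I -> nat) A :
  (forall i, f i \in nsum (n i) A) -> \sum_i f i \in nsum (\sum_i n i) A.
Proof.
move=> H; elim/big_rec2: _ => [|i x y _ h]; first by rewrite nsum0P.
exact: mem_nsumD.
Qed.

(** By commutativity only the number of uses of each summand matters. This makes the size of
    [nsum k A] polynomial in [k], and it is what allows Euclidean division of multiplicities in
    [nsum_doubling]. *)
Lemma nsum_multiplicity k A x : x \in nsum k A ->
  exists2 n : {ffun G -> 'I_k.+1},
    (forall y, y \notin A -> n y = ord0) & x = \sum_y y *+ n y.
Proof.
elim: k x => [|k IH] x.
  rewrite nsum0P => /eqP ->; exists [ffun=> ord0] => [y _|].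
    by rewrite ffunE.
  by rewrite big1 // => y _; rewrite ffunE.
move=> /nsumSP[y [z [yA /IH[n n0 ->] ->]]].
exists [ffun t => inord (n t + (t == y))%N] => [t tA|].
  apply/val_inj; rewrite ffunE n0 //= add0n inordK.
    by case: eqP tA => // ->; rewrite yA.
  by case: eqP.
rewrite (bigD1 y) //= [RHS](bigD1 y) //= addrA; congr (_ + _).
  rewrite ffunE eqxx addn1 inordK; last by rewrite ltnS.
  by rewrite mulrS.
apply: eq_bigr => t /negPf ty; rewrite ffunE ty addn0 inordK //.
by rewrite ltnW // ltnS.
Qed.

Lemma card_combinations (I : finType) (m : nat) (P : pred I)
    (f : {ffun I -> 'I_m.+1} -> G) (S : {set G}) :
  (forall x, x \in S -> exists2 n : {ffun I -> 'I_m.+1},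
    (forall i, ~~ P i -> n i = ord0) & x = f n) ->
  (#|S| <= m.+1 ^ #|P|)%N.
Proof.
move=> H.
have sub : S \subset
    [set f n | n in pffun_on (@ord0 m) P [set: 'I_m.+1]]%SET.
  apply/subsetP => x /H[n n0 ->]; apply/imsetP; exists n => //.
  apply/pffun_onP; split => [|y _]; last by rewrite inE.
  apply/subsetP => i; rewrite inE; apply: contraNT => ni.
  by rewrite n0.
apply: leq_trans (subset_leq_card sub) _.
apply: leq_trans (leq_imset_card _ _) _.
by rewrite card_pffun_on cardsT card_ord.
Qed.

Lemma card_nsum_le k A : (#|nsum k A| <= k.+1 ^ #|A|)%N.
Proof.
apply: (@card_combinations _ k (mem A) (fun n => \sum_y y *+ n y)).
by move=> x /nsum_multiplicity.
Qed.

(** Choose [T] maximal in [3 B] with disjoint translates [t + B]. They all lie in [4 B], so there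
    are at most [K] of them. By maximality the translate [x + B] of any [x] in [3 B] meets some
    [t + B], and symmetry of [B] turns [B - B] into [2 B]. *)
Lemma ruzsa_covering B (K : nat) : 0 \in B -> symmetric_set B ->
  (#|nsum 4 B| <= K * #|B|)%N ->
  exists2 T : {set G}, T \subset nsum 3 B /\ (#|T| <= K)%N &
    nsum 3 B \subset sumset T (nsum 2 B).
Proof.
move=> B0 Bs BK.
pose P (T : {set G}) := (T \subset nsum 3 B) &&
  [forall t in T, forall t' in T, forall b in B, forall b' in B,
     (t + b == t' + b') ==> (t == t')].
have PP T : reflect (T \subset nsum 3 B /\ forall t t' b b', t \in T ->
    t' \in T -> b \in B -> b' \in B -> t + b = t' + b' -> t = t') (P T).
  apply: (iffP andP) => -[T3 H]; split=> //.
    move=> t t' b b' tT tT' bB bB' e.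
    move/forall_inP: H => /(_ _ tT) /forall_inP/(_ _ tT').
    move=> /forall_inP/(_ _ bB) /forall_inP/(_ _ bB').
    by rewrite e eqxx => /eqP.
  apply/forall_inP => t tT; apply/forall_inP => t' tT'.
  apply/forall_inP => b bB; apply/forall_inP => b' bB'.
  by apply/implyP => /eqP e; rewrite (H t t' b b').
have [T /maxsetP[/PP[T3 Tinj] Tmax]] : {T | maxset P T & finset.set0 \subset T}.
  by apply: maxset_exists; apply/PP; split=> [|t t' b b']; rewrite ?sub0set ?inE.
move=> _; exists T.
  split=> //.
  have cT : #|sumset T B| = (#|T| * #|B|)%N.
    rewrite -cardsX card_in_imset // => -[t b] [t' b'].
    rewrite !inE /= => /andP[tT bB] /andP[tT' bB'] e.
    have tt' : t = t' by apply: (Tinj _ _ b b').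
    by move: e; rewrite tt' => /addrI ->.
  have : (#|sumset T B| <= #|nsum 4 B|)%N.
    apply/subset_leq_card/subsetP => _ /sumsetP[t [b [/(subsetP T3) t3 bB ->]]].
    by rewrite (@mem_nsumD 3 1) // nsum1.
  rewrite cT => h; have B1 : (0 < #|B|)%N by apply/card_gt0P; exists 0.
  by rewrite -(leq_pmul2r B1); apply: leq_trans BK.
apply/subsetP => x x3; apply: contraT => xn.
suff xT : x \in T.
  by rewrite -[x]addr0 mem_sumset // ?mem_nsum_0 // in xn.
have <- : x |: T = T; last by rewrite setU11.
have far t b b' : t \in T -> b \in B -> b' \in B -> x + b <> t + b'.
  move=> tT bB bB' e; case/negP: xn.
  have -> : x = t + (b' - b) by rewrite addrA -e addrK.
  rewrite mem_sumset // (@mem_nsumD 1 1) // nsum1 //; exact: Bs.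
apply: Tmax; last exact: subsetU1.
apply/PP; split=> [|t t' b b'].
  by rewrite subUset sub1set x3.
rewrite !inE => /orP[/eqP ->|tT] /orP[/eqP ->|tT'] bB bB' // e.
- by case: (far _ _ _ tT' bB bB').
- by case: (far _ _ _ tT bB' bB).
- exact: (Tinj _ _ b b').
Qed.

(** Each further summand from [B] is traded, through the covering of [3 B], for one translate in
    [T], while the part in [2 B] never grows. *)
Lemma nsum_covering B T j : nsum 3 B \subset sumset T (nsum 2 B) ->
  nsum (j + 2) B \subset sumset (nsum j T) (nsum 2 B).
Proof.
move=> cov; elim: j => [|j IH].
  apply/subsetP => x x2; rewrite -[x]add0r mem_sumset //.
  by rewrite nsum0P.
rewrite addSn; apply/subsetP => _ /nsumSP[b [z [bB /(subsetP IH) zj ->]]].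
move/sumsetP: zj => [u [v [uT vB ->]]].
have /sumsetP[t [w [tT wB e]]] : b + v \in sumset T (nsum 2 B).
  by apply: (subsetP cov); rewrite (@mem_nsumD 1 2) // nsum1.
have -> : b + (u + v) = (t + u) + w by rewrite addrCA e addrA [u + t]addrC.
by rewrite mem_sumset // mem_sumset.
Qed.

(* The multiplicities of the covering translates are split as [q * l + r] with
   [l] a small multiple of [m]; the remainders are absorbed in [m B]. *)
Lemma nsum_doubling B (K m : nat) : 0 \in B -> symmetric_set B ->
  (#|nsum 4 B| <= K * #|B|)%N -> (8 * K <= m)%N ->
  (#|nsum (4 * m) B| <= (32 * K).+1 ^ K * #|nsum m B|)%N.
Proof.
move=> B0 Bs BK Km.
have B1 : (0 < #|B|)%N by apply/card_gt0P; exists 0.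
have K0 : (0 < K)%N.
  case: K BK Km => // BK _; have := card_nsum_gt0 4 B0; lia.
have [T [T3 cT] cov] := ruzsa_covering B0 Bs BK.
(* The remainders cost [3 * l] copies of [B] for each of at most [K] translates, and the covering
   costs 2 more; [3 * K * l + 2 <= 4 * K * l <= m] makes them fit. The quotients are at most
   [32 * K] because [m <= 8 * K * l]. *)
pose l := (m %/ (4 * K))%N.
have lm1 : (l * (4 * K) <= m)%N by rewrite leq_trunc_div.
have lm2 : (m < l.+1 * (4 * K))%N by rewrite -ltn_divLR //; lia.
have l1 : (1 < l)%N by rewrite /l leq_divRL; lia.
have lm3 : (m <= l * (8 * K))%N by nia.
pose f (n : {ffun G -> 'I_(32 * K).+1}) := \sum_y y *+ (n y * l).
pose D := [set f n | n in pffun_on (@ord0 (32 * K)) (mem T) [set: 'I_(32 * K).+1]]%SET.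
have cD : (#|D| <= (32 * K).+1 ^ K)%N.
  apply: (@leq_trans ((32 * K).+1 ^ #|T|)); last by rewrite leq_exp2l //; lia.
  apply: leq_trans (leq_imset_card _ _) _.
  by rewrite card_pffun_on cardsT card_ord.
apply: (@leq_trans #|sumset D (nsum m B)|); last first.
  by apply: leq_trans (card_sumset_le _ _) _; rewrite leq_mul2r cD orbT.
apply/subset_leq_card/subsetP => x xm.
have /sumsetP[u [v [uT vB ->]]] :
    x \in sumset (nsum (4 * m - 2) T) (nsum 2 B).
  by apply: (subsetP (nsum_covering _ cov)); rewrite subnK //; lia.
have [n n0 ->] := nsum_multiplicity uT.
have nb y : (n y %/ l < (32 * K).+1)%N.
  rewrite ltnS; have h := ltn_ord (n y).
  have : (n y < (32 * K) * l)%N by nia.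
  move=> h2; rewrite -ltnS ltnW // ltnS; rewrite ltn_divLR //; lia.
pose q : {ffun G -> 'I_(32 * K).+1} := [ffun y => Ordinal (nb y)].
have -> : \sum_y y *+ n y + v = f q + (\sum_y y *+ (n y %% l) + v).
  rewrite addrA /f -big_split /=; congr (_ + _); apply: eq_bigr => y _.
  by rewrite ffunE /= -mulrnDr -divn_eq.
apply: mem_sumset.
  apply/imsetP; exists q => //; apply/pffun_onP; split => [|y _]; last by rewrite inE.
  apply/subsetP => y; rewrite inE; apply: contraNT => yT.
  by apply/eqP/val_inj; rewrite ffunE /= n0 //= div0n.
have h y : y *+ (n y %% l) \in nsum (if y \in T then l * 3 else 0) B.
  case: ifPn => yT; last by rewrite n0 //= mod0n mulr0n nsum0P.
  apply: (subsetP (@nsum_mono (n y %% l * 3) _ _ B0 _)).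
    by rewrite leq_mul2r /= ltnW // ltn_pmod //; lia.
  by rewrite nsum_mul mem_nsumMn // (subsetP T3).
have h2 : (\sum_y (if y \in T then l * 3 else 0) <= K * (l * 3))%N.
  by rewrite -big_mkcond /= sum_nat_const leq_mul2r cT orbT.
have := mem_nsumD (mem_nsum_sum h) vB.
apply: (subsetP (nsum_mono B0 _)).
apply: leq_trans (leq_add h2 (leqnn 2)) _.
have : (1 * 2 <= K * l)%N by apply: leq_mul.
lia.
Qed.

(** Otherwise each of the [h] steps from [h X] to [2h X] would add more than $K|hX|/h$ elements, and
    already [2h X] would be larger than the hypothesis allows for [4h X]. *)
Lemma slow_growth_step X (h K : nat) : 0 \in X -> (0 < h)%N ->
  (#|nsum (4 * h) X| <= K * #|nsum h X|)%N ->
  exists2 j, (h <= j < 2 * h)%N &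
    (h * (#|nsum j.+1 X| - #|nsum j X|) <= K * #|nsum j X|)%N.
Proof.
move=> X0 h0 hK.
have [/existsP[i hi]|/existsPn H] := boolP [exists i : 'I_h,
    (h * (#|nsum (h + i).+1 X| - #|nsum (h + i) X|) <= K * #|nsum (h + i) X|)%N].
  by exists (h + i)%N => //; have := ltn_ord i; lia.
exfalso.
have aux (b k e m c u i : nat) : (b <= k -> e <= m -> c <= e ->
    u + i <= e - c -> k < m - e -> b + u + i < m - c)%N by lia.
(* The extra summand [i] records the strictness of each step, so that the comparison at [i = h] is
   strict. *)
have grow i : (i <= h)%N ->
    (i * (K * #|nsum h X|) + i <= h * (#|nsum (h + i) X| - #|nsum h X|))%N.
  elim: i => // i IH ih; have {}IH := IH (ltnW ih).
  have := H (Ordinal ih); rewrite -ltnNge /= addnS.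
  have h1 : (#|nsum h X| <= #|nsum (h + i) X|)%N by apply: card_nsum_mono => //; lia.
  have h2 : (#|nsum (h + i) X| <= #|nsum (h + i).+1 X|)%N by apply: card_nsum_mono => //; lia.
  have h3 : (K * #|nsum h X| <= K * #|nsum (h + i) X|)%N by rewrite leq_mul2l h1 orbT.
  rewrite !mulnBr in IH *; move: IH.
  have : (h * #|nsum h X| <= h * #|nsum (h + i) X|)%N by rewrite leq_mul2l h1 orbT.
  have : (h * #|nsum (h + i) X| <= h * #|nsum (h + i).+1 X|)%N by rewrite leq_mul2l h2 orbT.
  rewrite (mulSn i) (addnS h i); move: h3; exact: aux.
have := grow h (leqnn h).
have : (h * (#|nsum (h + h) X| - #|nsum h X|) <= h * (K * #|nsum h X|))%N.
  rewrite leq_mul2l; apply/orP; right; apply: leq_trans (leq_subr _ _) _.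
  by apply: leq_trans hK; apply: card_nsum_mono => //; lia.
lia.
Qed.

End Sumsets.

Section SumsetScale.
Import mathcomp.boot.fintype mathcomp.boot.finset.
Local Open Scope set_scope.
Local Open Scope ring_scope.

(** Polynomial growth forces bounded quadrupling at some early scale [2 ^ (2 * j)], and
    [nsum_doubling] carries it up to the given scale [2 ^ s]. *)
Lemma nsum_doubling_scale (g : nat) : exists s0 K : nat, forall (G : finZmodType)
  (X : {set G}) s,
  0 \in X -> symmetric_set X -> (s0 <= s)%N ->
  (#|nsum (2 ^ s) X| <= 2 ^ (g * s))%N ->
  (#|nsum (2 ^ s) X| <= K * #|nsum (2 ^ (s - 2)) X|)%N.
Proof.
(* The exponent 7 comes from [s <= 4 * u + 3 <= 7 * u]: growth by more than [A] at all [u] scales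
   would exceed [2 ^ (g * s)]. *)
pose A := (2 ^ (7 * g))%N.
exists (14 * g + 20)%N, ((32 * A).+1 ^ A)%N => G X s X0 Xs s0s hs.
(* Only scales up to about [2 ^ (s / 2)] are searched, so that the remaining multiplier
   [2 ^ (s - 2 - 2 * j)] is at least [8 * A], as [nsum_doubling] requires. *)
pose u := (s %/ 4)%N.
have us : (4 * u <= s)%N by rewrite mulnC leq_trunc_div.
have su : (s < 4 * u.+1)%N by rewrite mulnC -ltn_divLR.
have u0 : (0 < u)%N by lia.
have [/existsP[j hj]|/existsPn H] := boolP [exists j : 'I_u,
    (#|nsum (2 ^ (2 * j + 2)) X| <= A * #|nsum (2 ^ (2 * j)) X|)%N]; last first.
  have grow j : (j <= u)%N -> (A ^ j <= #|nsum (2 ^ (2 * j)) X|)%N /\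
      ((0 < j)%N -> (A ^ j < #|nsum (2 ^ (2 * j)) X|)%N).
    elim: j => [_|j IH ju].
      by rewrite expn0; split=> //; apply: card_nsum_gt0.
    have [IH1 _] := IH (ltnW ju).
    have := H (Ordinal ju); rewrite -ltnNge /= => h.
    have e : (2 * j.+1 = 2 * j + 2)%N by lia.
    have h3 : (A ^ j.+1 < #|nsum (2 ^ (2 * j.+1)) X|)%N.
      apply: leq_ltn_trans (_ : A * #|nsum (2 ^ (2 * j)) X| < _)%N.
        by rewrite expnS leq_mul2l IH1 orbT.
      by rewrite e.
    by split=> //; apply: ltnW.
  have [_ /(_ u0)] := grow u (leqnn u).
  rewrite ltnNge => /negP[]; apply: leq_trans (leq_trans _ hs) _.
    by apply: card_nsum_mono => //; rewrite leq_exp2l //; lia.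
  by rewrite -expnM leq_exp2l //; nia.
have ju := ltn_ord j.
pose B := nsum (2 ^ (2 * j)) X.
have eB i : (2 * j <= i)%N -> nsum (2 ^ i) X = nsum (2 ^ (i - 2 * j)) B.
  by move=> ji; rewrite -nsum_mul -expnD subnK.
have := @nsum_doubling _ B A (2 ^ (s - 2 - 2 * j)).
have <- : nsum (2 ^ (2 * j + 2)) X = nsum 4 B.
  by rewrite eB ?leq_addr // addnC addnK.
rewrite -eB; last by lia.
have -> : (4 * 2 ^ (s - 2 - 2 * j) = 2 ^ (s - 2 * j))%N.
  by rewrite -(expnD 2 2); congr (2 ^ _)%N; lia.
rewrite -eB; last by lia.
apply => //.
- exact: mem_nsum_0.
- exact: nsum_sym.
- by rewrite -(expnD 2 3) leq_exp2l //; lia.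
Qed.

End SumsetScale.

(** * Complex moduli, cosine estimates and the characters of $\mathbb{Z}/p\mathbb{Z}$ *)

Import ComplexField.Normc.

Lemma normc_sqr (R : rcfType) (z : R[i]) : (normc z ^+ 2)%:C%C = z * conjc z.
Proof.
case: z => a b; rewrite /normc sqr_sqrtr ?addr_ge0 ?sqr_ge0 //.
by apply/eqP; rewrite eq_complex /=; apply/andP; split; apply/eqP; ring.
Qed.

Lemma normc_ge0 (R : rcfType) (z : R[i]) : 0 <= normc z.
Proof. by case: z => a b; apply: sqrtr_ge0. Qed.

Lemma normc_sum (R : rcfType) (I : finType) (P : pred I) (f : I -> R[i]) :
  normc (\sum_(i | P i) f i) <= \sum_(i | P i) normc (f i).
Proof.
elim/big_rec2: _ => [|i y x _ h]; first by rewrite normc0.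
by apply: le_trans (le_normcD _ _) _; rewrite lerD2l.
Qed.

Lemma normc_prod (R : rcfType) (I : finType) (f : I -> R[i]) :
  normc (\prod_i f i) = \prod_i normc (f i).
Proof. by elim/big_rec2: _ => [|i y x _ <-]; rewrite ?normc1 // normcM. Qed.

Lemma ReM_real (R : rcfType) (a : R) (z : R[i]) :
  complex.Re (a%:C%C * z) = a * complex.Re z.
Proof. by case: z => x y /=; rewrite mul0r subr0. Qed.

Lemma conjcMr (R : rcfType) (a : R) (z : R[i]) :
  conjc (a%:C%C * z) = a%:C%C * conjc z.
Proof. by rewrite rmorphM /= oppr0. Qed.

Lemma normc_geRe (R : rcfType) (z : R[i]) : complex.Re z <= normc z.
Proof.
case: z => a b /=; apply: le_trans (ler_norm _) _.
by rewrite -sqrtr_sqr ler_wsqrtr // lerDl sqr_ge0.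
Qed.

Section CosineBounds.
Variable R : realType.

Definition expi (t : R) : R[i] := (cos t +i* sin t)%C.

Lemma expiD s t : expi (s + t) = expi s * expi t.
Proof.
apply/eqP; rewrite eq_complex /= cosD sinD; apply/andP.
by split; apply/eqP; ring.
Qed.

Lemma expi0 : expi 0 = 1.
Proof. by rewrite /expi cos0 sin0. Qed.

Lemma expiN t : expi (- t) = conjc (expi t).
Proof. by rewrite /expi cosN sinN. Qed.

Lemma normc_expi t : normc (expi t) = 1.
Proof. by rewrite /normc /= cos2Dsin2 sqrtr1. Qed.

Lemma expi_2pi_int (z : int) : expi (pi *+ 2 * z%:~R) = 1.
Proof.
have h (n : nat) : expi (pi *+ 2 * n%:R) = 1.
  elim: n => [|n IH]; first by rewrite mulr0 expi0.
  by rewrite -natr1 mulrDr mulr1 expiD IH mul1r /expi cos2pi sin2pi.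
case: z => n; first by rewrite -pmulrn h.
by rewrite NegzE mulrNz mulrN expiN -pmulrn h conjc1.
Qed.

Lemma oneBcos_double (t : R) : 1 - cos (t *+ 2) <= 4 * (1 - cos t).
Proof.
rewrite cos_mulr2n -subr_ge0.
have -> : 4 * (1 - cos t) - (1 - (cos t ^+ 2 *+ 2 - 1)) = 2 * (1 - cos t) ^+ 2.
  by ring.
by rewrite mulr_ge0 ?sqr_ge0.
Qed.

(** Doubling [c] multiplies the left side by exactly 4 and the right side by at most 4, so it
    suffices to treat [p <= 4 * c], where the cosine is nonpositive and the left side is at most
    1. *)
Lemma oneBcos_ge (p c : nat) : (2 * c <= p)%N ->
  4 * (c%:R / p%:R) ^+ 2 <= 1 - cos (pi *+ 2 * c%:R / p%:R : R).
Proof.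
case: c => [_|c]; first by rewrite mul0r expr0n /= !mulr0 mul0r cos0 subrr.
move: c.+1 (ltn0Sn c) => {}c.
have [k] := ubnP (p - c)%N; elim: k c => // k IH c kc c0 cp.
have p0 : (0 : R) < p%:R by rewrite ltr0n; lia.
have [h|h] := leqP p (4 * c)%N; last first.
  have {IH} := IH (2 * c)%N ltac:(lia) ltac:(lia) ltac:(lia).
  have -> : pi *+ 2 * (2 * c)%:R / p%:R = (pi *+ 2 * c%:R / p%:R) *+ 2 :> R.
    by rewrite natrM -[RHS]mulr_natr; ring.
  move=> /le_trans/(_ (oneBcos_double _)).
  rewrite natrM; set t := c%:R / p%:R.
  have -> : (2 * c%:R / p%:R) = 2 * t :> R by rewrite /t mulrA.
  by rewrite exprMn; lra.
have c2 : c%:R / p%:R <= 2^-1 :> R.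
  by rewrite ler_pdivrMr // ler_pdivlMl // -natrM ler_nat.
have c4 : 4^-1 <= c%:R / p%:R :> R.
  by rewrite ler_pdivlMr // ler_pdivrMl // -natrM ler_nat.
have cos0 : cos (pi *+ 2 * c%:R / p%:R : R) <= 0.
  have := pi_gt0 R => pi0.
  rewrite -mulrA; set t := c%:R / p%:R in c2 c4 *.
  have h1 : pi * t <= pi * 2^-1 by rewrite ler_pM2l.
  have h2 : pi * 4^-1 <= pi * t by rewrite ler_pM2l.
  rewrite -cos_pihalf -(mulr_natr pi 2).
  have [->//|ne] := eqVneq (pi / 2 : R) (pi * 2 * t).
  rewrite ltW // ltr_cos ?in_itv /=; try by apply/andP; split; lra.
  rewrite lt_neqAle ne /=; lra.
have : 4 * (c%:R / p%:R) ^+ 2 <= 1 :> R.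
  have : 0 <= c%:R / p%:R :> R by rewrite divr_ge0 ?ler0n.
  move: (c%:R / p%:R) c2 c4 => t c2 c4 t0; nra.
lra.
Qed.

Lemma oneBcos_le_half (p c : nat) : (0 < p)%N -> (8 * c <= p)%N ->
  1 - cos (pi *+ 2 * c%:R / p%:R : R) <= 2^-1.
Proof.
move=> p0 cp; have pi0 := pi_gt0 R.
have p0' : (0 : R) < p%:R by rewrite ltr0n.
have c8 : c%:R / p%:R <= 8^-1 :> R.
  by rewrite ler_pdivrMr // ler_pdivlMl // -natrM ler_nat.
have c0 : 0 <= c%:R / p%:R :> R by rewrite divr_ge0 ?ler0n.
rewrite -mulrA; set t := c%:R / p%:R in c8 c0 *.
have q0 : 0 <= cos (pi / 4 : R) by apply: cos_ge0_pihalf; apply/andP; split; lra.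
have := cos_mulr2n (pi / 4 : R).
have -> : (pi / 4) *+ 2 = pi / 2 :> R by rewrite -mulr_natr; lra.
rewrite cos_pihalf => q2.
have q1 : 2^-1 <= cos (pi / 4 : R).
  rewrite -mulr_natr in q2; set c' := cos _ in q0 q2 *; nra.
suff : cos (pi / 4 : R) <= cos (pi *+ 2 * t) by lra.
have h1 : pi * t <= pi * 8^-1 by rewrite ler_pM2l.
have h2 : 0 <= pi * t by rewrite mulr_ge0 // ltW.
rewrite -(mulr_natr pi 2).
have [->//|ne] := eqVneq (pi / 4 : R) (pi * 2 * t).
rewrite ltW // ltr_cos ?in_itv /=; try by apply/andP; split; lra.
rewrite lt_neqAle eq_sym ne /=; lra.
Qed.

End CosineBounds.

Section Character.
Variables (R : realType) (p : nat).
Hypothesis p_prime : prime p.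
Implicit Types x y z xi : 'F_p.

Let p_gt0 : (0 < p)%N. Proof. exact: prime_gt0. Qed.
Let pR_gt0 : (0 : R) < p%:R. Proof. by rewrite ltr0n. Qed.

Definition chi x : R[i] := expi (pi *+ 2 * (nat_of_ord x)%:R / p%:R).

Lemma chi_nat (n : nat) : chi n%:R = expi (pi *+ 2 * n%:R / p%:R).
Proof.
rewrite /chi val_Fp_nat // [in RHS](divn_eq n p) natrD natrM.
have -> : pi *+ 2 * ((n %/ p)%:R * p%:R + (n %% p)%:R) / p%:R
  = pi *+ 2 * (n %/ p)%:Z%:~R + pi *+ 2 * (n %% p)%:R / p%:R :> R.
  by rewrite -pmulrn; field; rewrite gt_eqF.
by rewrite expiD expi_2pi_int mul1r.
Qed.

Lemma chiD x y : chi (x + y) = chi x * chi y.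
Proof.
rewrite -[x in LHS]natr_Zp -[y in LHS]natr_Zp -natrD chi_nat.
by rewrite natrD mulrDr mulrDl expiD.
Qed.

Lemma chi0 : chi 0 = 1.
Proof. by rewrite /chi /= mulr0 mul0r expi0. Qed.

Lemma normc_chi x : normc (chi x) = 1. Proof. exact: normc_expi. Qed.

Lemma chiN x : chi (- x) = conjc (chi x).
Proof.
have n0 : chi x != 0.
  by apply/eqP => h; have := normc_chi x; rewrite h normc0 => /eqP; rewrite eq_sym oner_eq0.
apply: (mulfI n0); rewrite -chiD subrr chi0 -normc_sqr normc_chi expr1n.
by [].
Qed.

Lemma chi1_neq1 : chi 1 != 1.
Proof.
have p1 := prime_gt1 p_prime; have pi0 := pi_gt0 R.
rewrite -[X in chi X]/(1%:R) chi_nat mulr1 eq_complex negb_and /=.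
apply/orP; left; rewrite lt_eqF //.
have h0 : 0 < pi *+ 2 / p%:R :> R by rewrite divr_gt0 // mulrn_wgt0.
have h1 : pi *+ 2 / p%:R <= pi :> R.
  by rewrite ler_pdivrMr // -(mulr_natr pi 2) ler_pM2l // ler_nat.
have : cos (pi *+ 2 / p%:R : R) < cos 0.
  by rewrite ltr_cos ?in_itv /= ?lexx ?pi_ge0 ?h1 ?(ltW h0).
by rewrite cos0.
Qed.

Lemma sum_chi x : \sum_xi chi (x * xi) = if x == 0 then p%:R else 0.
Proof.
case: eqP => [->|/eqP x0].
  rewrite (eq_bigr (fun=> 1)) => [|xi _]; last by rewrite mul0r chi0.
  by rewrite sumr_const card_Fp.
rewrite -(reindex_inj (F := chi) (P := xpredT) (mulfI x0)) /=.
have h : \sum_xi chi xi = chi 1 * \sum_xi chi xi.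
  rewrite mulr_sumr [LHS](reindex_inj (addrI (1 : 'F_p))) /=.
  by apply: eq_bigr => xi _; rewrite chiD.
have /eqP : (chi 1 - 1) * \sum_xi chi xi = 0.
  by rewrite mulrBl mul1r -h subrr.
by rewrite mulf_eq0 subr_eq0 (negPf chi1_neq1) => /eqP.
Qed.

Lemma parseval (f : 'F_p -> R) :
  \sum_xi normc (\sum_x (f x)%:C%C * chi (x * xi)) ^+ 2 =
  p%:R * \sum_x f x ^+ 2.
Proof.
apply: (@complexI R); rewrite rmorph_sum /=.
have E xi : ((normc (\sum_x (f x)%:C%C * chi (x * xi)) ^+ 2)%:C)%C =
    \sum_x \sum_y (f x * f y)%:C%C * chi ((x - y) * xi).
  rewrite normc_sqr rmorph_sum mulr_suml; apply: eq_bigr => x _.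
  rewrite mulr_sumr; apply: eq_bigr => y _.
  rewrite [X in _ * X]conjcMr -chiN mulrACA -rmorphM -chiD.
  by rewrite mulrBl.
rewrite (eq_bigr _ (fun xi _ => E xi)) exchange_big /=.
rewrite rmorphM rmorph_sum rmorph_nat mulr_sumr; apply: eq_bigr => x _.
rewrite exchange_big (bigD1 x) //= [X in _ + X]big1 ?addr0; last first.
  by move=> y yx; rewrite -mulr_sumr sum_chi subr_eq0 eq_sym (negPf yx) mulr0.
by rewrite -mulr_sumr sum_chi subrr eqxx mulrC expr2.
Qed.

Definition phi x : R := 1 - complex.Re (chi x).

Lemma phi0 : phi 0 = 0. Proof. by rewrite /phi chi0 /= subrr. Qed.

Lemma phi_ge0 x : 0 <= phi x.
Proof. by rewrite subr_ge0 /= cos_le1. Qed.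

Lemma phi_le2 x : phi x <= 2.
Proof. by have := cos_geN1 (pi *+ 2 * (nat_of_ord x)%:R / p%:R : R); rewrite /phi /=; lra. Qed.

Lemma phiN x : phi (- x) = phi x.
Proof. by rewrite /phi chiN; case: (chi x). Qed.

(** Through this identity the square root of [phi] inherits the triangle inequality of the
    modulus. *)
Lemma normc_1Bchi x : normc (1 - chi x) ^+ 2 = 2 * phi x.
Proof.
rewrite /phi /chi /expi; set t := (_ / _ : R) => /=.
rewrite sqr_sqrtr ?addr_ge0 ?sqr_ge0 //.
by have := cos2Dsin2 t; set c := cos t; set s := sin t => h; nra.
Qed.

Definition centered x : int :=
  if (2 * nat_of_ord x <= p)%N then (nat_of_ord x)%:Z else (nat_of_ord x)%:Z - p%:Z.

Lemma centered_val x : (centered x)%:~R = x.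
Proof.
rewrite /centered; case: ifP => _; first by rewrite -pmulrn natr_Zp.
rewrite rmorphB /= -!pmulrn natr_Zp.
by rewrite (_ : p%:R = 0) ?subr0 //; apply: pchar_Fp_0.
Qed.

Lemma absz_centered_le x : (2 * `|centered x| <= p)%N.
Proof.
have := ltn_ord x; rewrite [X in (_ < X)%N]Fp_cast // => h.
by rewrite /centered; case: ifP => h2; lia.
Qed.

Lemma phi_int (z : int) : phi z%:~R = 1 - cos (pi *+ 2 * `|z|%:R / p%:R).
Proof.
case: z => n; first by rewrite -pmulrn /phi chi_nat.
by rewrite NegzE mulrNz phiN -pmulrn /phi chi_nat.
Qed.

Lemma phi_ge_centered x : 4 * (`|centered x|%:R / p%:R) ^+ 2 <= phi x.
Proof. by rewrite -{2}[x]centered_val phi_int oneBcos_ge ?absz_centered_le. Qed.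

Lemma phi_le_half (z : int) : (8 * `|z| <= p)%N -> phi z%:~R <= 2^-1.
Proof. by move=> h; rewrite phi_int oneBcos_le_half. Qed.

End Character.

(** * Large spectrum of an almost invariant sumset *)

Lemma sqr_sum_le (R : realFieldType) (I : finType) (A : {set I}) (f : I -> R) :
  (\sum_(i in A) f i) ^+ 2 <= #|A|%:R * \sum_(i in A) f i ^+ 2.
Proof.
set s := \sum_(i in A) f i; set q := \sum_(i in A) f i ^+ 2.
have [A0|A0] := posnP #|A|.
  by rewrite /s big_pred0 ?expr0n ?A0 ?mul0r // => i; apply: card0_eq.
have c0 : 0 < #|A|%:R :> R by rewrite ltr0n.
have : 0 <= \sum_(i in A) (f i - s / #|A|%:R) ^+ 2.
  by apply: sumr_ge0 => i _; apply: sqr_ge0.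
have -> : \sum_(i in A) (f i - s / #|A|%:R) ^+ 2 = q - s ^+ 2 / #|A|%:R.
  rewrite (eq_bigr (fun i => f i ^+ 2 + ((- (2 * (s / #|A|%:R))) * f i +
    (s / #|A|%:R) ^+ 2))); last by move=> i _; ring.
  rewrite !big_split /= -mulr_sumr sumr_const -/s -/q -mulr_natr.
  by field; rewrite gt_eqF.
by rewrite subr_ge0 ler_pdivrMr // mulrC.
Qed.

Section Spectrum.
Import mathcomp.boot.fintype mathcomp.boot.finset.
Local Open Scope set_scope.
Local Open Scope ring_scope.
Variables (R : realType) (p : nat).
Hypothesis p_prime : prime p.
Implicit Types (x y xi : 'F_p) (B S X Y : {set 'F_p}).

Let pR_gt0 : (0 : R) < p%:R. Proof. by rewrite ltr0n prime_gt0. Qed.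

Definition hat B xi : R[i] := \sum_(x in B) chi R (x * xi).

Lemma hat_indicator B xi :
  hat B xi = \sum_x ((x \in B)%:R : R)%:C%C * chi R (x * xi).
Proof.
rewrite /hat big_mkcond; apply: eq_bigr => x _.
by case: (x \in B); rewrite ?mul1r ?mul0r.
Qed.

Lemma normc_hat_le B xi : normc (hat B xi) <= #|B|%:R.
Proof.
apply: le_trans (normc_sum _ _) _.
by rewrite (eq_bigr (fun=> 1)) ?sumr_const // => x _; rewrite normc_chi.
Qed.

Lemma hat_parseval B : \sum_xi normc (hat B xi) ^+ 2 = p%:R * #|B|%:R.
Proof.
under eq_bigr do rewrite hat_indicator.
rewrite parseval //; congr (_ * _).
rewrite -sum1_card natr_sum [RHS]big_mkcond; apply: eq_bigr => x _.
by case: (x \in B); rewrite ?expr1n // expr0n.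
Qed.

(** Points and frequencies exchange roles: at each point of [Y] the transform of [S] has real part
    at least $|S|/2$, and Parseval leaves room for at most $4p/|S|$ such points. It is applied both
    to an iterated sumset and to a box of combinations. *)
Lemma card_small_phi_sum S Y :
  (forall x, x \in Y -> \sum_(xi in S) phi R (x * xi) <= #|S|%:R / 2) ->
  (#|Y| * #|S| <= 4 * p)%N.
Proof.
move=> H.
have [->|S0] := posnP #|S|; first by rewrite muln0.
have c0 : 0 < #|S|%:R :> R by rewrite ltr0n.
have low x : x \in Y -> (#|S|%:R / 2) ^+ 2 <= normc (hat S x) ^+ 2.
  move=> /H h; rewrite ler_pXn2r // ?nnegrE ?divr_ge0 ?normc_ge0 ?ler0n //.
  apply: le_trans (normc_geRe _).
  have -> : complex.Re (hat S x) = #|S|%:R - \sum_(xi in S) phi R (x * xi).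
    rewrite /phi sumrB sumr_const opprB addrC subrK /hat.
    rewrite (big_morph (@complex.Re R) (id1 := 0) (op1 := +%R)) //; last first.
      by move=> [a b] [].
    by apply: eq_bigr => i _; rewrite mulrC.
  lra.
have : #|Y|%:R * (#|S|%:R / 2) ^+ 2 <= p%:R * #|S|%:R :> R.
  rewrite -hat_parseval mulr_natl -sumr_const.
  apply: le_trans (ler_sum _ low) _.
  rewrite [leRHS](bigID (mem Y)) /= lerDl.
  by apply: sumr_ge0 => x _; apply: sqr_ge0.
rewrite -(ler_nat R) !natrM -(ler_pM2r c0).
by move: #|S|%:R => s; lra.
Qed.

(** The square of [hat B] is the transform of the number of representations as a sum of two elements
    of [B]. Parseval turns the fourth moment into additive energy, and Cauchy-Schwarz on [2 B]
    bounds the energy from below. *)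
Lemma additive_energy B :
  p%:R * #|B|%:R ^+ 4 <= #|nsum 2 B|%:R * \sum_xi normc (hat B xi) ^+ 4 :> R.
Proof.
pose r z : R := \sum_(u in setX B B) (u.1 + u.2 == z)%:R.
have hr xi : hat B xi ^+ 2 = \sum_z (r z)%:C%C * chi R (z * xi).
  rewrite expr2 /hat mulr_suml.
  transitivity (\sum_(u in setX B B) chi R ((u.1 + u.2) * xi)).
    rewrite (eq_bigl (fun u => (u.1 \in B) && (u.2 \in B))); last first.
      by move=> [a b]; rewrite inE.
    rewrite -(pair_big (mem B) (mem B) (fun a b => chi R ((a + b) * xi))) /=.
    by apply: eq_bigr => x _; rewrite mulr_sumr; apply: eq_bigr => y _; rewrite mulrDl chiD.
  rewrite /r; under [RHS]eq_bigr do rewrite rmorph_sum mulr_suml.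
  rewrite exchange_big /=; apply: eq_bigr => u _.
  rewrite (bigD1 (u.1 + u.2)) //= eqxx mul1r big1 ?addr0 // => z /negPf.
  by rewrite eq_sym => ->; rewrite mul0r.
have -> : \sum_xi normc (hat B xi) ^+ 4 = p%:R * \sum_z r z ^+ 2.
  rewrite -parseval //; apply: eq_bigr => xi _.
  by rewrite -hr (expr2 (hat B xi)) normcM -expr2 -exprM.
have sr : \sum_(z in nsum 2 B) r z = #|B|%:R ^+ 2.
  rewrite /r exchange_big /= (eq_bigr (fun=> 1)) ?sumr_const ?cardsX.
    by rewrite natrM expr2.
  move=> [a b]; rewrite inE /= => /andP[aB bB].
  have ab : a + b \in nsum 2 B by rewrite (@mem_nsumD _ 1 1) ?nsum1.
  rewrite (bigD1 (a + b)) //= eqxx big1 ?addr0 // => z /andP[_ /negPf].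
  by rewrite eq_sym => ->.
have := sqr_sum_le (nsum 2 B) r; rewrite sr -exprM => h.
rewrite [leRHS]mulrCA ler_pM2l //; apply: le_trans h _.
rewrite ler_wpM2l ?ler0n // [leRHS](bigID (mem (nsum 2 B))) /= lerDl.
by apply: sumr_ge0 => x _; apply: sqr_ge0.
Qed.

(** The threshold $|B|/\sqrt{2K}$ is such that, when $|2B|\le K|B|$, the frequencies below it carry
    at most half of the lower bound on the fourth moment given by [additive_energy]. *)
Definition large_spectrum (K : nat) B : {set 'F_p} :=
  [set xi | #|B|%:R ^+ 2 <= (2 * K)%:R * normc (hat B xi) ^+ 2].

Lemma card_large_spectrum B (K : nat) : (0 < #|B|)%N ->
  (#|nsum 2 B| <= K * #|B|)%N -> (p <= 2 * K * #|B| * #|large_spectrum K B|)%N.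
Proof.
move=> B0 BK; set G := large_spectrum K B.
have b0 : 0 < #|B|%:R :> R by rewrite ltr0n.
set b : R := #|B|%:R in b0 *.
have bK : #|nsum 2 B|%:R <= K%:R * b by rewrite -natrM ler_nat.
have K0 : (0 : R) <= K%:R by rewrite ler0n.
have E := additive_energy B; rewrite -/b in E.
have E0 : 0 <= \sum_xi normc (hat B xi) ^+ 4.
  by apply: sumr_ge0 => xi _; rewrite exprn_ge0 ?normc_ge0.
have {}E : p%:R * b ^+ 3 <= K%:R * \sum_xi normc (hat B xi) ^+ 4.
  have := le_trans E (ler_wpM2r E0 bK); set q := \sum_xi _.
  have -> : p%:R * b ^+ 4 = p%:R * b ^+ 3 * b by ring.
  have -> : K%:R * b * q = K%:R * q * b by ring.
  by rewrite ler_pM2r.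
have hG : \sum_(xi in G) normc (hat B xi) ^+ 4 <= #|G|%:R * b ^+ 4.
  rewrite mulr_natl -sumr_const; apply: ler_sum => xi _.
  by rewrite lerXn2r ?nnegrE ?normc_ge0 ?ler0n // normc_hat_le.
have hN : (2 * K)%:R * \sum_(xi | xi \notin G) normc (hat B xi) ^+ 4 <=
    b ^+ 2 * (p%:R * b).
  rewrite -hat_parseval mulr_sumr [X in _ <= _ * X](bigID (mem G)) /= mulrDr.
  rewrite -[leLHS]add0r lerD //.
    by rewrite mulr_ge0 ?sqr_ge0 // sumr_ge0 // => xi _; apply: sqr_ge0.
  rewrite mulr_sumr; apply: ler_sum => xi.
  rewrite inE -ltNge => /ltW h.
  rewrite (_ : 4 = 2 + 2)%N // exprD mulrA.
  by rewrite ler_wpM2r ?sqr_ge0.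
rewrite (bigID (mem G)) /= in E.
suff : p%:R * b ^+ 3 <= (2 * K)%:R * #|G|%:R * b ^+ 4.
  have -> : (2 * K)%:R * #|G|%:R * b ^+ 4 = (2 * K)%:R * b * #|G|%:R * b ^+ 3.
    by ring.
  by rewrite ler_pM2r ?exprn_gt0 // /b -!natrM ler_nat.
set v := \sum_(i in G) _ in hG E; set u := \sum_(i | i \notin G) _ in hN E.
rewrite natrM in hN *.
have : K%:R * v <= K%:R * (#|G|%:R * b ^+ 4) by rewrite ler_wpM2l.
lra.
Qed.

(** At a slow step both [j X] and its translate by [x] fill [(j+1) X] up to a proportion [K / h].
    Hence multiplication by [chi (x * xi)] barely changes the transform of [j X] at [xi]; where this
    transform is large, [chi (x * xi)] must be close to 1. *)
Lemma spectrum_almost_period X (h K : nat) : 0 \in X -> symmetric_set X ->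
  (0 < h)%N -> (#|nsum (4 * h) X| <= K * #|nsum h X|)%N ->
  exists j (S : {set 'F_p}), [/\ (h <= j < 2 * h)%N,
    (p <= 2 * K * #|nsum j X| * #|S|)%N &
    forall x xi, x \in X -> xi \in S -> (`|centered (x * xi)%R| * h <= K ^ 2 * p)%N].
Proof.
move=> X0 Xs h0 hK; have [j hj dj] := slow_growth_step X0 h0 hK.
exists j, (large_spectrum K (nsum j X)); split=> //.
  apply: card_large_spectrum; first exact: card_nsum_gt0.
  rewrite -nsum_mul; apply: leq_trans (leq_trans hK _).
    by apply: card_nsum_mono => //; lia.
  by rewrite leq_mul2l card_nsum_mono ?orbT //; lia.
move=> x xi xX; rewrite inE.
set B := nsum j X in dj *; set B' := nsum j.+1 X in dj *.
have BB' : B \subset B' by apply: nsum_mono.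
have cB : (#|B| <= #|B'|)%N by apply: subset_leq_card.
set D := (#|B'| - #|B|)%N in dj.
have diff (A : {set 'F_p}) : A \subset B' -> #|A| = #|B| ->
    normc (hat B' xi - hat A xi) <= D%:R.
  move=> AB' cA; rewrite {1}/hat (big_setID A) /= (setIidPr AB') addrAC subrr add0r.
  apply: le_trans (normc_hat_le (B' :\: A) xi) _.
  by rewrite ler_nat cardsD (setIidPr AB') cA.
have shift : hat [set x + y | y in B] xi = chi R (x * xi) * hat B xi.
  rewrite /hat big_imset /=; last by move=> y z _ _ /addrI.
  by rewrite mulr_sumr; apply: eq_bigr => y _; rewrite mulrDl chiD.
have D2 : normc ((1 - chi R (x * xi)) * hat B xi) <= 2 * D%:R.
  have -> : (1 - chi R (x * xi)) * hat B xi =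
      (hat B' xi - hat [set x + y | y in B] xi) + - (hat B' xi - hat B xi).
    by rewrite shift; ring.
  apply: le_trans (le_normcD _ _) _; rewrite normcN mulr_natl mulr2n.
  apply: lerD; apply: diff => //.
    by apply/subsetP => _ /imsetP[y yB ->]; apply/nsumSP; exists x, y.
  by rewrite card_imset //; apply: addrI.
have b0 : 0 < #|B|%:R :> R by rewrite ltr0n card_nsum_gt0.
set b : R := #|B|%:R in b0 *.
move=> hb; have {}hb : b ^+ 2 <= (2 * K)%:R * normc (hat B xi) ^+ 2 := hb.
have ph := phi_ge_centered R p_prime (x * xi).
have N := normc_1Bchi R (x * xi).
set f := phi R _ in ph N; set c := `|centered _|%N in ph *.
have D2' : (2 * f) * normc (hat B xi) ^+ 2 <= 4 * D%:R ^+ 2.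
  rewrite -N -exprMn -normcM (_ : 4 * _ = (2 * D%:R) ^+ 2); last by ring.
  by rewrite lerXn2r ?nnegrE ?normc_ge0 ?mulr_ge0 ?ler0n.
have f0 : 0 <= f by apply: phi_ge0.
have h1 : f * b ^+ 2 <= 4 * K%:R * D%:R ^+ 2.
  have k0 := ler0n R K; have := ler_wpM2l f0 hb; rewrite natrM.
  by have := ler_wpM2l k0 D2'; lra.
have h2 : h%:R ^+ 2 * D%:R ^+ 2 <= K%:R ^+ 2 * b ^+ 2 :> R.
  by rewrite -!exprMn lerXn2r ?nnegrE ?mulr_ge0 ?ler0n // -!natrM ler_nat.
have h3 : f * h%:R ^+ 2 <= 4 * K%:R ^+ 3.
  have b2 : 0 < b ^+ 2 by rewrite exprn_gt0.
  rewrite -(ler_pM2r b2).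
  have := ler_wpM2r (sqr_ge0 (h%:R : R)) h1.
  have K4 : 0 <= 4 * K%:R :> R by rewrite mulr_ge0 ?ler0n.
  have := ler_wpM2l K4 h2.
  by lra.
have h4 : (c%:R * h%:R) ^+ 2 <= K%:R ^+ 3 * p%:R ^+ 2 :> R.
  have : (c%:R / p%:R) ^+ 2 * h%:R ^+ 2 <= K%:R ^+ 3 :> R.
    have := ler_wpM2r (sqr_ge0 (h%:R : R)) ph; move: h3; clear; lra.
  by rewrite -exprMn mulrAC expr_div_n ler_pdivrMr // exprn_gt0.
have K1 : (0 < K)%N.
  case: (posnP K) hK (card_nsum_gt0 (4 * h) X0) => // ->.
  by rewrite mul0n leqn0 => /eqP ->.
(* The factor [K ^ 3] is rounded up to [K ^ 4], a square, so that the root can be taken in the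
   naturals. *)
have : ((c * h) ^ 2 <= (K ^ 2 * p) ^ 2)%N.
  rewrite -(ler_nat R) natrX natrM; apply: le_trans h4 _.
  rewrite -natrX -natrX -natrM ler_nat expnMn -expnM leq_mul2r.
  by rewrite leq_pexp2l // orbT.
by rewrite leq_exp2r.
Qed.

End Spectrum.

(** * Boxes, symmetric progressions and integer lifts of frequencies *)

Section Boxes.
Variables (r : nat) (H : 'I_r -> nat).

Definition box := {dffun forall i : 'I_r, 'I_(2 * H i).+1}.

Definition box_val (f : box) (i : 'I_r) : int := (f i : nat)%:Z - (H i)%:Z.

Lemma card_box : #|{: box}| = (\prod_i (2 * H i).+1)%N.
Proof.
rewrite card_dep_ffun foldrE big_map big_enum /=.
by apply: eq_bigr => i _; rewrite card_ord.
Qed.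

Lemma absz_box_val f i : (`|box_val f i| <= H i)%N.
Proof. by have := ltn_ord (f i); rewrite /box_val; lia. Qed.

Lemma box_val_inj f g : (forall i, box_val f i = box_val g i) -> f = g.
Proof.
move=> e; apply/ffunP => i; apply/val_inj.
by have := e i; rewrite /box_val /=; lia.
Qed.

Lemma box_valP (n : 'I_r -> int) : (forall i, `|n i| <= H i)%N ->
  exists f : box, forall i, box_val f i = n i.
Proof.
move=> nH.
have lt i : (`|(n i + (H i)%:Z)%R| < (2 * H i).+1)%N by have := nH i; lia.
exists [ffun i => Ordinal (lt i)] => i.
by rewrite /box_val ffunE /=; have := nH i; lia.
Qed.

End Boxes.

Section SymmetricGap.
Variables (G : finZmodType) (r : nat) (a : 'I_r -> G) (J : 'I_r -> nat).

Definition symmetric_gap : gap G r :=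
  Gap 0 a (fun i => - (J i)%:Z) (fun i => (J i)%:Z).

Lemma mem_symmetric_gap (n : 'I_r -> int) : (forall i, `|n i| <= J i)%N ->
  gap_set symmetric_gap (\sum_i a i *~ n i).
Proof.
by move=> nJ; exists n; rewrite /= /gap_map /= ?add0r // => i; have := nJ i => /=; lia.
Qed.

Lemma card_symmetric_gap :
  (#|gap_set symmetric_gap| <= \prod_i (2 * J i).+1)%N.
Proof.
rewrite -card_box.
apply: leq_trans (leq_imset_card (fun f : box J => \sum_i a i *~ box_val f i) _).
apply/subset_leq_card/fintype.subsetP => x; rewrite in_setE => -[n nJ <-].
have [|f fn] := @box_valP _ J n.
  by move=> i; have := nJ i => /=; lia.
apply/imsetP; exists f => //.
by rewrite /gap_map add0r; apply: eq_bigr => i _; rewrite fn.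
Qed.

Lemma proper_symmetric_gap :
  (forall n m : 'I_r -> int, (forall i, `|n i| <= J i)%N ->
     (forall i, `|m i| <= J i)%N ->
     \sum_i a i *~ n i = \sum_i a i *~ m i -> forall i, n i = m i) ->
  gap_proper symmetric_gap.
Proof.
move=> inj n m; rewrite !in_setE => nJ mJ; rewrite /gap_map !add0r => e.
apply/funext => i; apply: (inj n m) => // j.
  by have := nJ j => /=; lia.
by have := mJ j => /=; lia.
Qed.

End SymmetricGap.

Section Forms.
Variables (p : nat) (S : {set 'F_p}).

(** An integer lift of multiplication by [xi] after evaluation. Least absolute residues are not
    additive on residues, but this sum is additive on formal combinations, hence the domain. The
    value 0 off [S] lets the family be indexed by all of ['F_p]. *)
Definition spectral_form (xi : 'F_p) (v : {ffun 'F_p -> int}) : int :=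
  if xi \in S then \sum_x v x * centered (x * xi) else 0.

Lemma spectral_form_zmod xi : zmod_morphism (spectral_form xi).
Proof.
move=> u v; rewrite /spectral_form; case: ifP => _; last by rewrite subrr.
by rewrite -sumrB; apply: eq_bigr => x _; rewrite !ffunE mulrBl.
Qed.

HB.instance Definition _ xi :=
  GRing.isZmodMorphism.Build _ _ (spectral_form xi) (spectral_form_zmod xi).

Definition eval_ffun (v : {ffun 'F_p -> int}) : 'F_p := \sum_x x *~ v x.

Lemma eval_ffun_zmod : zmod_morphism eval_ffun.
Proof.
move=> u v; rewrite /eval_ffun -sumrB; apply: eq_bigr => x _.
by rewrite !ffunE mulrzBr.
Qed.

HB.instance Definition _ :=
  GRing.isZmodMorphism.Build _ _ eval_ffun eval_ffun_zmod.

Definition delta_ffun (x : 'F_p) : {ffun 'F_p -> int} := [ffun y => (y == x)%:R].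

Lemma eval_delta x : eval_ffun (delta_ffun x) = x.
Proof.
rewrite /eval_ffun (bigD1 x) //= big1 ?addr0 => [|y /negPf yx].
  by rewrite ffunE eqxx.
by rewrite ffunE yx mulr0z.
Qed.

Lemma spectral_form_delta xi x :
  spectral_form xi (delta_ffun x) = if xi \in S then centered (x * xi) else 0.
Proof.
rewrite /spectral_form; case: ifP => // _.
rewrite (bigD1 x) //= big1 ?addr0 => [|y /negPf yx].
  by rewrite ffunE eqxx mul1r.
by rewrite ffunE yx mul0r.
Qed.

Lemma mul_eval_ffun xi v : prime p -> xi \in S ->
  eval_ffun v * xi = (spectral_form xi v)%:~R.
Proof.
move=> pp xiS; rewrite /spectral_form xiS /eval_ffun mulr_suml rmorph_sum /=.
apply: eq_bigr => x _.
by rewrite rmorphM /= centered_val // mulrzAl mulrzl.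
Qed.

End Forms.

Lemma intr_Fp_eq0 (p : nat) (z : int) : prime p ->
  z%:~R = 0 :> 'F_p -> (`|z| < p)%N -> z = 0.
Proof.
move=> pp; have h (n : nat) : n%:R = 0 :> 'F_p -> (n < p)%N -> n = 0%N.
  move=> /(congr1 (fun x : 'F_p => nat_of_ord x)); rewrite val_Fp_nat //=.
  by move=> n0 np; rewrite modn_small in n0.
case: z => n; first by rewrite -pmulrn => /h e /e ->.
rewrite NegzE mulrNz -pmulrn => /eqP; rewrite oppr_eq0 => /eqP /h e /= lt.
by have := e lt.
Qed.

(** [H] describes the box on which residues determine coefficients, [J] the smaller box that
    suffices for [X]. Both are inversely proportional to the norms of the reduced basis, which
    yields the comparison between them; the alternative [r = k] means that the budget of vectors ran
    out. *)
Lemma bohr_gap (R : realType) (p : nat) (S X : {set 'F_p}) (h K k : nat) :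
  prime p -> (0 < h)%N -> (0 < k)%N -> (exists2 xi, xi \in S & xi != 0) ->
  (forall x xi, x \in X -> xi \in S -> `|centered (x * xi)%R| * h <= K * p)%N ->
  exists r (a : 'I_r -> 'F_p) (H J : 'I_r -> nat), (r <= k)%N /\
  [/\ (\prod_i (2 * H i).+1 * #|S| <= 4 * p)%N,
   forall i, (h <= 16 * k * 4 ^ k * K * (H i).+1)%N,
   forall i, (J i * h <= cover_const k * K * 16 * k * (H i).+1)%N,
   forall n m : 'I_r -> int, (forall i, `|n i| <= H i)%N ->
     (forall i, `|m i| <= H i)%N ->
     \sum_i a i *~ n i = \sum_i a i *~ m i -> forall i, n i = m i &
   (r < k)%N -> forall x, x \in X -> exists2 n : 'I_r -> int,
      (forall i, `|n i| <= J i)%N & x = \sum_i a i *~ n i].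
Proof.
move=> pp h0 k0 [xi0 xi0S xi0n] hX; have p0 := prime_gt0 pp.
pose L xi : {additive {ffun 'F_p -> int} -> int} := spectral_form S xi.
pose D := (K * p %/ h)%N.
have Dh : (D * h <= K * p)%N by rewrite leq_trunc_div.
have LD x : x \in X -> (supnorm L (delta_ffun x) <= D)%N.
  move=> xX; apply/supnorm_leP => xi; rewrite /L /= spectral_form_delta.
  by case: ifP => // xiS; rewrite leq_divRL //; apply: hX.
have [|r [b [rk ind bD cov]]] :=
    @short_basis _ _ k L (fun v => exists2 x, x \in X & v = delta_ffun x) D.
  by move=> _ [x xX ->]; apply: LD.
pose M i := supnorm L (b i).
have M0 i : (0 < M i)%N.
  rewrite lt0n; apply/negP => e.
  have := ind (fun j => (j == i)%:R).
  have -> : \sum_(j < r) b j *~ (j == i)%:R = b i.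
    by rewrite (bigD1 i) //= eqxx big1 ?addr0 // => j /negPf ->; rewrite mulr0z.
  by move=> /(_ (eqP e) i); rewrite eqxx.
pose E := cover_const k.
(* As [r <= k], all forms are at most [p / 16] on this box. A difference of two points thus has
   forms below [p], which vanish as soon as they vanish mod [p], and [phi] is at most 1/2 at every
   frequency of [S]. *)
pose H i := (p %/ (16 * k * M i))%N.
pose J i := (E * D %/ M i)%N.
have kM i : (0 < 16 * k * M i)%N by rewrite !muln_gt0 k0 M0.
have Hlow i : (p < (H i).+1 * (16 * k * M i))%N by rewrite -ltn_divLR.
have Hup i : (H i * (16 * k * M i) <= p)%N by rewrite leq_trunc_div.
have ev (n : 'I_r -> int) :
    \sum_i eval_ffun (b i) *~ n i = eval_ffun (\sum_i b i *~ n i).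
  by rewrite raddf_sum; apply: eq_bigr => i _; rewrite raddfMz.
have boxM (n : 'I_r -> int) : (forall i, `|n i| <= H i)%N ->
    (16 * supnorm L (\sum_i b i *~ n i)%R <= p)%N.
  move=> nH; rewrite -(leq_pmul2r k0).
  apply: (@leq_trans (\sum_(i < r) p)); last first.
    by rewrite sum_nat_const card_ord mulnC leq_mul2l rk orbT.
  apply: leq_trans (_ : 16 * k * (\sum_i (`|n i| * M i)) <= _)%N.
    rewrite -mulnA [(_ * k)%N]mulnC mulnA leq_mul2l.
    apply/orP; right; apply: leq_trans (supnorm_sum _ _) _.
    by apply: leq_sum => i _; rewrite supnormMz.
  rewrite big_distrr /=; apply: leq_sum => i _; apply: leq_trans (Hup i).
  by rewrite mulnCA leq_mul2r nH orbT.
have inj n m : (forall i, `|n i| <= H i)%N -> (forall i, `|m i| <= H i)%N ->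
    \sum_i eval_ffun (b i) *~ n i = \sum_i eval_ffun (b i) *~ m i ->
    forall i : 'I_r, n i = m i.
  move=> nH mH; rewrite !ev => /eqP; rewrite -subr_eq0 -raddfB => /eqP e.
  suff /ind : supnorm L (\sum_i b i *~ (n i - m i)) = 0%N.
    by move=> z i; apply/eqP; rewrite -subr_eq0 z.
  have -> : \sum_i b i *~ (n i - m i) =
      \sum_i b i *~ n i - \sum_i b i *~ m i.
    by rewrite -sumrB; apply: eq_bigr => i _; rewrite mulrzBr.
  set v := _ - _ in e *.
  apply/eqP/supnorm_eq0P => xi; rewrite /L /=.
  have [xiS|xiS] := boolP (xi \in S); last by rewrite /spectral_form (negPf xiS).
  apply: (@intr_Fp_eq0 p); first by [].
    by rewrite -mul_eval_ffun // e mul0r.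
  apply: leq_ltn_trans (supnorm_ge L xi v) _.
  apply: leq_ltn_trans (supnormB _ _ _) _.
  by have := boxM _ nH; have := boxM _ mH; move: p0; clear; lia.
exists r, (fun i => eval_ffun (b i)), H, J; split=> //; split=> //.
- rewrite -card_box -(card_imset (f := fun f : box H =>
    \sum_i eval_ffun (b i) *~ box_val f i)); last first.
    move=> f g e; apply: box_val_inj; apply: inj => //.
      by move=> i; apply: absz_box_val.
    by move=> i; apply: absz_box_val.
  apply: (@card_small_phi_sum R p pp) => _ /imsetP[f _ ->].
  rewrite mulr_natl -sumr_const; apply: ler_sum => xi xiS.
  rewrite ev (mul_eval_ffun _ pp xiS); apply: phi_le_half => //.
  have := boxM _ (absz_box_val f).
  have := supnorm_ge L xi (\sum_i b i *~ box_val f i).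
  by rewrite /L /=; lia.
- move=> i.
  have := Hlow i; have := bD i; rewrite -/(M i) => h1 h2.
  rewrite -(leq_pmul2r p0) [(h * p)%N]mulnC.
  apply: leq_trans (_ : (H i).+1 * (16 * k * M i) * h <= _)%N.
    by rewrite leq_mul2r ltnW ?orbT.
  have : (M i * h <= 4 ^ k * (K * p))%N.
    apply: (@leq_trans (4 ^ k * D * h)); first by rewrite leq_mul2r h1 orbT.
    by rewrite -mulnA leq_mul2l Dh orbT.
  rewrite -(leq_pmul2l (_ : 0 < (H i).+1 * (16 * k))%N) ?muln_gt0 ?k0 //.
  by move=> h3; apply: leq_trans (leq_trans _ h3) _; apply: eq_leq; ring.
- move=> i.
  rewrite -(leq_pmul2r (M0 i)).
  apply: (@leq_trans (E * (K * p))).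
    have : (J i * M i * h <= E * D * h)%N by rewrite leq_mul2r leq_trunc_div orbT.
    have : (E * (D * h) <= E * (K * p))%N by rewrite leq_mul2l Dh orbT.
    rewrite -!mulnA [(h * _)%N]mulnC => h1 h2; exact: leq_trans h2 h1.
  rewrite /E; apply: leq_trans (_ : cover_const k * (K * ((H i).+1 * (16 * k * M i))) <= _)%N.
    by rewrite !leq_mul2l (ltnW (Hlow i)) !orbT.
  by apply: eq_leq; ring.
- move=> rk' x xX.
  have [|n [n0 nJ]] := cov rk' (delta_ffun x); first by exists x.
  exists n.
    move=> i; rewrite leq_divRL //; apply: leq_trans (nJ i) _.
    by rewrite leq_mul2l LD ?orbT.
  (* The difference has vanishing forms; multiplying by the single nonzero frequency [xi0] turns
     this into equality of residues. *)
  apply/eqP; rewrite -subr_eq0 -(mulIr_eq0 _ (mulIf xi0n)) ev -[X in X - _]eval_delta.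
  rewrite -raddfB (mul_eval_ffun _ pp xi0S).
  by move/eqP/supnorm_eq0P: n0 => /(_ xi0); rewrite /L /= => ->.
Qed.

(** * From polynomial growth of sumsets to a progression *)

Lemma prodn_le (I : finType) (f g : I -> nat) :
  (forall i, f i <= g i)%N -> (\prod_i f i <= \prod_i g i)%N.
Proof.
by move=> fg; elim/big_rec2: _ => // i x y _ xy; apply: leq_mul.
Qed.

(** With $k=2^s$ the last clause reads $|Q|\le K(1+|kX|/k^r)$, cleared of denominators. *)
Definition small_doubling_gap (p : nat) (X : {set 'F_p}) (g s K : nat) : Prop :=
  exists r (Q : gap 'F_p r), [/\ (0 < r <= g.+1)%N,
    gap_proper Q, gap_symmetric Q, (forall x, x \in X -> gap_set Q x) &
    (#|gap_set Q| * 2 ^ (s * r) <= K * (2 ^ (s * r) + #|nsum (2 ^ s) X|))%N].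

(** The rank has to be positive, so the case of rank zero in [inverse_sumset] is replaced by a
    one-point progression of rank one. *)
Lemma trivial_gap (p : nat) (X : {set 'F_p}) (g s K : nat) : (0 < K)%N ->
  (forall x, x \in X -> x = 0) -> small_doubling_gap X g s K.
Proof.
move=> K0 X0; pose a (i : 'I_1) : 'F_p := 0.
exists 1%N, (symmetric_gap a (fun=> 0%N)); split => //.
- apply: proper_symmetric_gap => n m n0 m0 _ i.
  by have := n0 i; have := m0 i; lia.
- move=> x /X0 ->; have := @mem_symmetric_gap _ _ a (fun=> 0%N) (fun=> 0).
  by rewrite big1 => [|i _]; rewrite ?mulr0z //; apply.
apply: leq_mul; last exact: leq_addr.
by apply: leq_trans (card_symmetric_gap _ _) _; rewrite big_ord_recl big_ord0.
Qed.

Lemma inverse_sumset (R : realType) (g : nat) : exists s0 K : nat, (0 < K)%N /\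
  forall (p : nat) (X : {set 'F_p}) (s : nat), prime p ->
  0 \in X -> symmetric_set X -> (s0 <= s)%N ->
  (#|nsum (2 ^ s) X| <= 2 ^ (g * s))%N ->
  (K * #|nsum (2 ^ s) X| <= p)%N -> small_doubling_gap X g s K.
Proof.
have [s1 [A doubling]] := nsum_doubling_scale g.
pose k := g.+1.
pose c := (16 * k * 4 ^ k * A ^ 2)%N.
pose c' := (cover_const k * A ^ 2 * 16 * k)%N.
(* The first term excludes rank [k]; the terms in [c] and [c'] ensure [0 < H i] and [J i <= H i]. *)
pose h0 := (8 * A * 4 ^ g * c ^ k + 2 * c + 2 * c' + 1)%N.
pose K := (2 * A + 1 + 4 ^ k * (2 * c' + c + 1) ^ k * (8 * A))%N.
exists (s1 + h0 + 2)%N, K; split; first by rewrite /K; lia.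
move=> p X s pp X0 Xs hs sX pX.
have p0 := prime_gt0 pp.
have K1 : (2 * A + 1 <= K)%N by rewrite /K; lia.
have K2 : (4 ^ k * (2 * c' + c + 1) ^ k * (8 * A) <= K)%N by rewrite /K; lia.
clearbody K.
pose h := (2 ^ (s - 2))%N.
have h4 : (4 * h = 2 ^ s)%N by rewrite /h -(expnD 2 2); congr (2 ^ _)%N; lia.
have hh0 : (h0 < h)%N.
  by apply: leq_trans (ltn_expl h0 (leqnn 2)) _; rewrite leq_exp2l //; lia.
have hpos : (0 < h)%N by lia.
have hA : (#|nsum (4 * h) X| <= A * #|nsum h X|)%N.
  by rewrite h4; apply: doubling => //; lia.
have [j [S [hj pS hX]]] := spectrum_almost_period R pp X0 Xs hpos hA.
have jN : (#|nsum j X| <= #|nsum (2 ^ s) X|)%N.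
  by apply: card_nsum_mono => //; rewrite -h4; lia.
set N := #|nsum (2 ^ s) X| in sX pX jN *.
have N0 : (0 < N)%N by apply: card_nsum_gt0.
have {}pS : (p <= 2 * A * N * #|S|)%N.
  by apply: leq_trans pS _; rewrite leq_mul2r leq_mul2l jN !orbT.
(* Here [K * N <= p] enters: with at most one frequency, [p <= 2 * A * N], which is too small. A
   second frequency guarantees a nonzero one. *)
have S1 : (1 < #|S|)%N.
  rewrite ltnNge; apply/negP => S1.
  have : (2 * A * N * #|S| <= 2 * A * N)%N by rewrite -[leqRHS]muln1 leq_mul2l S1 orbT.
  have : ((2 * A + 1) * N <= K * N)%N by rewrite leq_mul2r K1 orbT.
  rewrite mulnDl mul1n => h1 h2.
  have h3 := leq_trans pS h2; have h5 := leq_trans h1 pX.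
  by have := leq_trans h5 h3; rewrite -[leqRHS]addn0 leq_add2l leqNgt N0.
have nz : exists2 xi, xi \in S & xi != 0.
  have [/existsP[xi /andP[xiS xi0]]|/existsPn Sz] :=
    boolP [exists xi, (xi \in S) && (xi != 0)]; first by exists xi.
  have /subset_leq_card : S \subset finset.set1 0.
    apply/fintype.subsetP => xi xiS; rewrite finset.inE.
    by have := Sz xi; rewrite xiS negbK.
  by rewrite cards1 leqNgt S1.
have [r [a [H [J [rk [prodH cH cJ inj cov]]]]]] :=
  bohr_gap R pp hpos (ltn0Sn g : (0 < k)%N) nz hX.
have S0 : (0 < #|S|)%N by lia.
have prodN : (\prod_i (2 * H i).+1 <= 8 * A * N)%N.
  rewrite -(leq_pmul2r S0); apply: leq_trans prodH _.
  apply: (@leq_trans (4 * (2 * A * N * #|S|))); first by rewrite leq_mul2l pS orbT.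
  by apply: eq_leq; ring.
(* At rank [k = g + 1] the box would have at least [(h / c) ^ (g + 1)] points, while its size is at
   most [8 * A * N] and [N <= (4 * h) ^ g]. *)
have rk' : (r < k)%N.
  rewrite ltn_neqAle rk andbT; apply/eqP => er.
  have low : (h ^ k <= c ^ k * (8 * A * N))%N.
    apply: leq_trans (_ : \prod_(i < r) (c * (2 * H i).+1) <= _)%N.
      rewrite -er -{1}(card_ord r) -prod_nat_const; apply: prodn_le => i.
      apply: leq_trans (cH i) _; rewrite -/c leq_mul2l; apply/orP; right; lia.
    by rewrite big_split /= prod_nat_const card_ord -er leq_mul2l prodN orbT.
  have NX : (N <= 4 ^ g * h ^ g)%N.
    by rewrite -expnMn h4 -expnM mulnC.
  have hg : (0 < h ^ g)%N by rewrite expn_gt0 hpos.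
  have : (h * h ^ g <= h0 * h ^ g)%N.
    rewrite -expnS; apply: leq_trans low _.
    apply: (@leq_trans (c ^ k * (8 * A * (4 ^ g * h ^ g)))).
      by rewrite !leq_mul2l NX !orbT.
    apply: (@leq_trans ((8 * A * 4 ^ g * c ^ k) * h ^ g)).
      by apply: eq_leq; ring.
    by rewrite leq_mul2r; apply/orP; right; rewrite /h0; lia.
  by rewrite leq_pmul2r // leqNgt hh0.
case: r => [|r] in a H J rk cH cJ inj cov prodH prodN rk' *.
  apply: trivial_gap; first by lia.
  by move=> x /(cov isT)[n _ ->]; rewrite big_ord0.
have H1 i : (0 < H i)%N.
  rewrite lt0n; apply/eqP => e; have := cH i; rewrite e muln1 -/c.
  by move: hh0; rewrite /h0; lia.
have JH i : (J i <= H i)%N.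
  have := cJ i; rewrite -/c' => h1.
  have h2 : (2 * c' < h)%N by move: hh0; rewrite /h0; lia.
  have : (J i * (2 * c') <= J i * h)%N by rewrite leq_mul2l (ltnW h2) orbT.
  case: (posnP (J i)) => [->//|J0].
  have : (J i * (2 * c') < J i * h)%N by rewrite ltn_mul2l J0.
  have := H1 i; move: h1; clear; move: (J i) (H i) => x y.
  rewrite leqNgt => h1 y0 h2 _; rewrite leqNgt; apply/negP => yx.
  have : (c' * y.+1 <= c' * x)%N by rewrite leq_mul2l yx orbT.
  lia.
exists r.+1, (symmetric_gap a J); split => //.
- apply: proper_symmetric_gap => n m nJ mJ; apply: inj => i.
    exact: leq_trans (nJ i) (JH i).
  exact: leq_trans (mJ i) (JH i).
- by move=> x /(cov rk')[n nJ ->]; apply: mem_symmetric_gap.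
have e2 : (2 ^ (s * r.+1) = 4 ^ r.+1 * h ^ r.+1)%N by rewrite -expnMn h4 expnM.
(* Side by side, [2 * J i + 1] is smaller than [2 * H i + 1] by a factor of order [h]; the product
   over [i] is the gain in the size of the progression. *)
have step : (\prod_i (2 * J i).+1 * h ^ r.+1 <=
    (2 * c' + c + 1) ^ r.+1 * \prod_i (2 * H i).+1)%N.
  have -> : (h ^ r.+1 = \prod_(i < r.+1) h)%N by rewrite prod_nat_const card_ord.
  have -> : ((2 * c' + c + 1) ^ r.+1 = \prod_(i < r.+1) (2 * c' + c + 1))%N.
    by rewrite prod_nat_const card_ord.
  rewrite -!big_split /=; apply: prodn_le => i.
  have := cH i; have := cJ i; rewrite -/c -/c'.
  have h1 : ((H i).+1 <= (2 * H i).+1)%N by lia.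
  have : (c * (H i).+1 <= c * (2 * H i).+1)%N by rewrite leq_mul2l h1 orbT.
  have : (c' * (H i).+1 <= c' * (2 * H i).+1)%N by rewrite leq_mul2l h1 orbT.
  clear; move: (H i) (J i) => x y; rewrite mulSn -mulnA !mulnDl; lia.
apply: (@leq_trans (K * N)); last by rewrite leq_mul2l leq_addl orbT.
rewrite e2 mulnCA.
have cg := card_symmetric_gap a J.
apply: (@leq_trans (4 ^ r.+1 * (\prod_i (2 * J i).+1 * h ^ r.+1))).
  by rewrite leq_mul2l leq_mul2r cg !orbT.
apply: (@leq_trans (4 ^ k * ((2 * c' + c + 1) ^ k * (8 * A * N)))); last first.
  apply: leq_trans (_ : 4 ^ k * (2 * c' + c + 1) ^ k * (8 * A) * N <= _)%N.
    by apply: eq_leq; ring.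
  by rewrite leq_mul2r K2 orbT.
apply: leq_mul; first by rewrite leq_exp2l // ltnW.
apply: leq_trans step _; apply: leq_mul => //.
by rewrite leq_pexp2l ?addn1 // ltnW.
Qed.

(** * Fourier bound for the concentration of a linear form *)

Lemma jensen_expR (R : realType) (I : finType) (P : pred I) (l y : I -> R) :
  (forall i, P i -> 0 <= l i) -> \sum_(i | P i) l i = 1 ->
  expR (\sum_(i | P i) l i * y i) <= \sum_(i | P i) l i * expR (y i).
Proof.
move=> l0 l1; set m := \sum_(i | P i) l i * y i.
(* Rewrite the left side as the weighted sum of the tangent line of the exponential at the mean
   [m]. *)
have -> : expR m = \sum_(i | P i) l i * (expR m * (1 + (y i - m))).
  transitivity (expR m * \sum_(i | P i) (l i * (1 - m) + l i * y i)).
    by rewrite big_split /= -mulr_suml l1 -/m mul1r subrK mulr1.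
  by rewrite mulr_sumr; apply: eq_bigr => i _; ring.
apply: ler_sum => i Pi; apply: ler_wpM2l; first exact: l0.
rewrite -[X in _ <= expR X](subrKC m) expRD ler_wpM2l ?expR_ge0 //.
exact: expR_ge1Dx.
Qed.

Section FourierBound.
Variables (R : realType) (p : nat).
Hypothesis p_prime : prime p.
Implicit Types (x y xi a b : 'F_p).

Let pR_gt0 : (0 : R) < p%:R. Proof. by rewrite ltr0n prime_gt0. Qed.

Variables (q : 'F_p -> R) (alpha : R).
Hypotheses (alpha_gt0 : 0 < alpha) (q_ge0 : forall b, 0 <= q b)
  (sum_q : \sum_b q b = 1) (q_le : forall b, q b <= 1 - alpha).

Definition char_fun x : R[i] := \sum_b (q b)%:C%C * chi R (b * x).

Let off (u : 'F_p * 'F_p) := u.1 != u.2.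
Let wt (u : 'F_p * 'F_p) := q u.1 * q u.2.
Let total := \sum_(u | off u) wt u.

(** The squared modulus is the characteristic function of the difference of two independent copies;
    pairs of equal values contribute [phi 0 = 0]. *)
Lemma normc_char_fun x :
  normc (char_fun x) ^+ 2 = 1 - \sum_(u | off u) wt u * phi R ((u.1 - u.2) * x).
Proof.
have sum_wt : \sum_(u : 'F_p * 'F_p) wt u = 1.
  rewrite -(pair_bigA _ (fun a b => q a * q b)) /=.
  under eq_bigr do rewrite -mulr_sumr sum_q mulr1.
  exact: sum_q.
have e : ((normc (char_fun x) ^+ 2)%:C)%C =
    \sum_(u : 'F_p * 'F_p) (wt u)%:C%C * chi R ((u.1 - u.2) * x).
  rewrite normc_sqr /char_fun rmorph_sum mulr_suml.
  rewrite -(pair_bigA _ (fun a b => (q a * q b)%:C%C * chi R ((a - b) * x))).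
  apply: eq_bigr => a _; rewrite mulr_sumr; apply: eq_bigr => b _.
  by rewrite [X in _ * X]conjcMr -chiN // mulrACA -rmorphM -chiD // mulrBl.
move/(congr1 (@complex.Re R)): e => /= ->.
rewrite (big_morph (@complex.Re R) (id1 := 0) (op1 := +%R)) //; last first.
  by move=> [a b] [].
under eq_bigr do rewrite ReM_real.
transitivity (\sum_u (wt u - wt u * phi R ((u.1 - u.2) * x))).
  by apply: eq_bigr => u _; rewrite /phi; ring.
rewrite sumrB sum_wt; congr (_ - _).
rewrite [RHS]big_mkcond; apply: eq_bigr => u _; rewrite /off.
by case: eqP => //= ->; rewrite subrr mul0r phi0 mulr0.
Qed.

(** Two independent copies agree with probability at most that of the largest atom. *)
Lemma total_ge : alpha <= total.
Proof.
have e : \sum_(u : 'F_p * 'F_p) wt u = 1.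
  rewrite -(pair_bigA _ (fun a b => q a * q b)) /=.
  under eq_bigr do rewrite -mulr_sumr sum_q mulr1.
  exact: sum_q.
have d : \sum_(u | ~~ off u) wt u <= 1 - alpha.
  rewrite (reindex_onto (fun b => (b, b)) (fun u => u.1)) /=; last first.
    by move=> [a b]; rewrite /off /= negbK => /eqP ->.
  rewrite (eq_bigl xpredT) => [|b]; last by rewrite /off /= !eqxx.
  have -> : 1 - alpha = \sum_b q b * (1 - alpha).
    by rewrite -mulr_suml sum_q mul1r.
  by apply: ler_sum => b _; rewrite /wt /= ler_wpM2l.
by move: e; rewrite (bigID off) /= -/total; lra.
Qed.

Lemma normc_char_fun_le x : normc (char_fun x) <=
  expR (- 2^-1 * \sum_(u | off u) wt u * phi R ((u.1 - u.2) * x)).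
Proof.
set s := \sum_(u | _) _.
rewrite -(@ler_pXn2r _ 2) ?nnegrE ?normc_ge0 ?expR_ge0 //.
rewrite normc_char_fun -/s -expRM_natr.
apply: le_trans (expR_ge1Dx _) _.
by rewrite ler_expR; lra.
Qed.

Variables (n : nat) (w : 'I_n -> 'F_p).

Definition weight_form xi : R := \sum_i phi R (w i * xi).

(** The exponent is an average over pairs of distinct values once the weights are divided by
    [total], and Jensen moves this average outside. The factor [total] left in the exponent is then
    lowered to [alpha]. *)
Lemma prod_char_fun_le xi : \prod_i normc (char_fun (w i * xi)) <=
  \sum_(u | off u) wt u / total *
    expR (- (alpha / 2) * weight_form ((u.1 - u.2) * xi)).
Proof.
have t0 : 0 < total by apply: lt_le_trans total_ge.
have wt0 u : 0 <= wt u by rewrite mulr_ge0.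
have : \prod_i normc (char_fun (w i * xi)) <= \prod_i expR (- 2^-1 *
    \sum_(u | off u) wt u * phi R ((u.1 - u.2) * (w i * xi))).
  by apply: ler_prod => i _; rewrite normc_ge0; apply: normc_char_fun_le.
move=> /le_trans; apply.
rewrite -expR_sum -mulr_sumr exchange_big /=.
have -> : - 2^-1 * \sum_(u | off u) \sum_i wt u * phi R ((u.1 - u.2) * (w i * xi))
  = \sum_(u | off u) wt u / total *
      (- (total / 2) * weight_form ((u.1 - u.2) * xi)).
  rewrite mulr_sumr; apply: eq_bigr => u _.
  rewrite -mulr_sumr /weight_form.
  under eq_bigr do rewrite mulrCA.
  by field; rewrite gt_eqF.
apply: le_trans (jensen_expR _ _ _) _.
- by move=> u _; rewrite divr_ge0 // ltW.
- by rewrite -mulr_suml divff // gt_eqF.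
apply: ler_sum => u _; apply: ler_wpM2l; first by rewrite divr_ge0 // ltW.
rewrite ler_expR.
rewrite ler_wpM2r //; last by have := total_ge; lra.
by apply: sumr_ge0 => i _; apply: phi_ge0.
Qed.

(** For a pair of distinct values, dilation by their difference permutes the nonzero frequencies.
    All pairs therefore give the same sum, and the normalised weights add up to 1. *)
Lemma sum_prod_char_fun_le :
  \sum_(xi | xi != 0) \prod_i normc (char_fun (w i * xi)) <=
  \sum_(xi | xi != 0) expR (- (alpha / 2) * weight_form xi).
Proof.
have t0 : 0 < total by apply: lt_le_trans total_ge.
apply: le_trans (ler_sum _ (fun xi _ => prod_char_fun_le xi)) _.
rewrite exchange_big /= -[leRHS]mul1r.
have <- : \sum_(u | off u) wt u / total = 1.
  by rewrite -mulr_suml divff // gt_eqF.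
rewrite mulr_suml; apply: ler_sum => u uoff; rewrite -mulr_sumr.
have u0 : u.1 - u.2 != 0 by rewrite subr_eq0.
rewrite [X in _ <= _ * X](reindex_inj (mulfI u0)) /=.
rewrite le_eqVlt; apply/orP; left; apply/eqP; congr (_ * _).
by apply: eq_bigl => xi; rewrite mulf_eq0 negb_or u0.
Qed.

Lemma fourier_bound a :
  `|\sum_(f : {ffun 'I_n -> 'F_p} | \sum_i f i * w i == a) \prod_i q (f i)
    - p%:R^-1| <=
  p%:R^-1 * \sum_(xi | xi != 0) expR (- (alpha / 2) * weight_form xi).
Proof.
set s := \sum_(f | _) _.
have inv : p%:R * s = 1 +
    complex.Re (\sum_(xi | xi != 0) chi R (- (a * xi)) * \prod_i char_fun (w i * xi)).
  have prodE xi : \prod_i char_fun (w i * xi) =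
      \sum_(f : {ffun 'I_n -> 'F_p})
        (\prod_i q (f i))%:C%C * chi R ((\sum_i f i * w i) * xi).
    rewrite bigA_distr_bigA /=; apply: eq_bigr => f _.
    rewrite big_split /= rmorph_prod; congr (_ * _).
    rewrite mulr_suml (big_morph (@chi R p) (chiD R p_prime) (chi0 R p)).
    by apply: eq_bigr => i _; rewrite mulrA.
  have p0 : \prod_i char_fun (w i * 0) = 1.
    rewrite big1 // => i _; rewrite /char_fun mulr0.
    under eq_bigr do rewrite mulr0 chi0 mulr1.
    by rewrite -rmorph_sum sum_q.
  have main : ((p%:R * s)%:C)%C =
      \sum_xi chi R (- (a * xi)) * \prod_i char_fun (w i * xi).
    under [RHS]eq_bigr do rewrite prodE mulr_sumr.
    rewrite exchange_big /= rmorphM rmorph_nat rmorph_sum mulr_sumr big_mkcond.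
    apply: eq_bigr => f _; set z := \sum_i f i * w i.
    rewrite (eq_bigr (fun xi => (\prod_i q (f i))%:C%C * chi R ((z - a) * xi))).
      rewrite -mulr_sumr sum_chi // subr_eq0.
      by case: (z == a); rewrite ?mulr0 // mulrC.
    by move=> xi _; rewrite mulrCA -chiD // mulrBl addrC.
  have -> : p%:R * s = complex.Re ((p%:R * s)%:C)%C by [].
  rewrite main (bigD1 0) //= mulr0 oppr0 chi0 p0 mul1r.
  by case: (\sum_(xi | _) _).
have -> : s - p%:R^-1 = p%:R^-1 * (p%:R * s - 1).
  by field; rewrite gt_eqF.
rewrite inv addrC addKr normrM gtr0_norm ?invr_gt0 //.
rewrite ler_wpM2l ?invr_ge0 ?ler0n //.
apply: le_trans sum_prod_char_fun_le.
set z := \sum_(xi | _) _ * _.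
apply: le_trans (_ : normc z <= _).
  by case: z => x y /=; rewrite -sqrtr_sqr ler_wsqrtr // lerDl sqr_ge0.
apply: le_trans (normc_sum _ _) _; apply: ler_sum => xi _.
by rewrite normcM normc_chi mul1r normc_prod.
Qed.

End FourierBound.

Local Open Scope classical_set_scope.
Local Open Scope ring_scope.

(** * From the law of [mu] to the bound on [rho] *)

Section RhoBound.
Variables (R : realType) (p n : nat) (alpha : R).
Hypotheses (p_prime : prime p) (alpha_gt0 : 0 < alpha).
Variables (d0 : measure_display) (T0 : measurableType d0)
  (P0 : probability T0 R) (mu : {RV P0 >-> 'F_p}).
Hypothesis balanced : alpha_balanced alpha mu.
Variables (d : measure_display) (T : measurableType d)
  (P : probability T R) (mus : 'I_n -> {RV P >-> 'F_p}).
Hypothesis iid : iid_copies mus mu.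
Variable w : 'I_n -> 'F_p.

Let q b : R := fine (P0 (mu @^-1` [set b])).

Let q_ge0 b : 0 <= q b.
Proof. exact/fine_ge0/measure_ge0. Qed.

Lemma finite_measure_bigcup (d' : measure_display) (T' : measurableType d')
    (P' : probability T' R) (I : finType) (A : pred I) (F : I -> set T') :
  trivIset [set` A] F -> (forall i, measurable (F i)) ->
  fine (P' (\bigcup_(i in [set` A]) F i)) = \sum_(i | A i) fine (P' (F i)).
Proof.
move=> tF mF; have finA : finite_set [set` A] by exact: finite_finpred.
rewrite measure_fin_bigcup //.
rewrite -(@bigfs _ _ _ _ (index_enum I)) ?index_enum_uniq //; last first.
  by move=> i _; rewrite mem_index_enum.
by rewrite -sum_fine // => i _; exact: fin_num_measure.
Qed.

Let sum_q : \sum_b q b = 1.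
Proof.
rewrite -(@finite_measure_bigcup _ _ P0 _ xpredT (fun b => mu @^-1` [set b])).
- rewrite (_ : \bigcup_(i in _) _ = setT) ?probability_setT //.
  by apply/seteqP; split=> // t _; exists (mu t).
- by move=> i j _ _ [t [/= -> ->]].
- by move=> b; apply: measurable_funPTI.
Qed.

Lemma prob_linear_form a :
  fine (P [set t | \sum_(i < n) mus i t * w i = a]) =
  \sum_(f : {ffun 'I_n -> 'F_p} | \sum_i f i * w i == a) \prod_i q (f i).
Proof.
have [indep same] := iid.
pose F (f : {ffun 'I_n -> 'F_p}) :=
  \bigcap_(i in [set: 'I_n]) (mus i @^-1` [set f i]).
have PF f : fine (P (F f)) = \prod_i q (f i).
  rewrite /F (indep (fun i => [set f i])) //.
  have h i : P (mus i @^-1` [set f i]) = (q (f i))%:E.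
    rewrite /q fineK ?fin_num_measure //; last exact: measurable_funPTI.
    exact: (same i [set f i]).
  rewrite (eq_bigr _ (fun i _ => h i)).
  by rewrite prodEFin.
rewrite -(eq_bigr _ (fun f _ => PF f)) -finite_measure_bigcup.
- congr (fine (P _)); apply/seteqP; split=> [t /= ta|t [f /= /eqP fa] Ft].
    exists [ffun i => mus i t] => /=.
      by rewrite -ta; apply/eqP/eq_bigr => i _; rewrite ffunE.
    by move=> i _ /=; rewrite ffunE.
  by rewrite -fa; apply: eq_bigr => i _; rewrite (Ft i).
- move=> f g _ _ [t [Ff Fg]]; apply/ffunP => i.
  by rewrite -(Ff i) // -(Fg i).
- move=> f; apply: fin_bigcap_measurable => //.
  by move=> i _; apply: measurable_funPTI.
Qed.

Lemma rho_le : rho mus w <=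
  p%:R^-1 * \sum_(xi | xi != 0) expR (- (alpha / 2) * weight_form R w xi).
Proof.
apply: ge_sup.
  by exists (`|fine (P [set t | \sum_(i < n) mus i t * w i = 0]) - p%:R^-1|), 0.
move=> _ [a _ <-]; rewrite prob_linear_form.
by apply: fourier_bound.
Qed.

End RhoBound.

(** * Selecting components, frequencies and level sets *)

Section Selection.
Import mathcomp.boot.fintype mathcomp.boot.finset.
Local Open Scope set_scope.
Local Open Scope ring_scope.
Variables (R : realType).

Lemma subset_of_card (I : finType) (A : {set I}) m : (m <= #|A|)%N ->
  exists2 B : {set I}, #|B| = m & B \subset A.
Proof.
move=> /card_geqP[s [us <- sA]]; exists [set x in s].
  by rewrite cardsE; apply/card_uniqP.
by apply/subsetP => x; rewrite inE; apply: sA.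
Qed.

Lemma markov_select n (f : 'I_n -> R) (B : R) (n' : nat) : 0 < B -> (0 < n')%N ->
  (forall i, 0 <= f i) -> \sum_i f i <= B ->
  exists2 W : {set 'I_n}, #|W| = (n - n')%N &
    forall i, i \in W -> f i <= B / n'%:R.
Proof.
move=> B0 n0 f0 fB.
have n0' : 0 < n'%:R :> R by rewrite ltr0n.
pose A := [set i | f i <= B / n'%:R].
have bad : (#|~: A| <= n')%N.
  have : #|~: A|%:R * (B / n'%:R) <= B.
    apply: le_trans (_ : \sum_(i in ~: A) f i <= _).
      rewrite mulr_natl -sumr_const; apply: ler_sum => i.
      by rewrite !inE -ltNge => /ltW.
    apply: le_trans fB.
    by rewrite [leRHS](bigID (mem (~: A))) /= lerDl sumr_ge0.
  by rewrite mulrA ler_pdivrMr // mulrC ler_pM2l // ler_nat.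
have [|W cW WA] := @subset_of_card _ A (n - n').
  by have := cardsC A; rewrite card_ord; move: bad; lia.
exists W => // i /(subsetP WA); by rewrite inE.
Qed.

Variables (p : nat).
Hypothesis p_prime : prime p.

(** Induction with a weighted triangle inequality: $k(k+1)a^2+(k+1)b^2-k(a+b)^2=(ka-b)^2$. These
    weights reproduce the constant $k^2$ exactly, with no loss at each step. *)
Lemma phi_sum_nsum (S X : {set 'F_p}) (B : R) k :
  (forall x, x \in X -> \sum_(xi in S) phi R (x * xi) <= B) ->
  forall x, x \in nsum k X -> \sum_(xi in S) phi R (x * xi) <= k%:R ^+ 2 * B.
Proof.
move=> XB; elim: k => [|k IH] x.
  rewrite nsum0P => /eqP ->; rewrite expr0n mul0r big1 // => xi _.
  by rewrite mul0r phi0.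
move=> /nsumSP[y [z [yX zk ->]]].
have [k0|k0] := posnP k.
  move: zk; rewrite k0 nsum0P => /eqP ->; rewrite addr0 expr1n mul1r.
  exact: XB.
have k0' : 0 < k%:R :> R by rewrite ltr0n.
have tri xi : k%:R * phi R ((y + z) * xi) <=
    k%:R * k.+1%:R * phi R (y * xi) + k.+1%:R * phi R (z * xi).
  suff : k%:R * (2 * phi R ((y + z) * xi)) <=
    k%:R * k.+1%:R * (2 * phi R (y * xi)) + k.+1%:R * (2 * phi R (z * xi)) by lra.
  rewrite -!(normc_1Bchi R).
  set a := normc (1 - chi R (y * xi)); set b := normc (1 - chi R (z * xi)).
  have h : normc (1 - chi R ((y + z) * xi)) <= a + b.
    have -> : 1 - chi R ((y + z) * xi) =
        (1 - chi R (y * xi)) + chi R (y * xi) * (1 - chi R (z * xi)).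
      by rewrite mulrDl chiD //; ring.
    by apply: le_trans (le_normcD _ _) _; rewrite normcM normc_chi mul1r.
  have h2 : normc (1 - chi R ((y + z) * xi)) ^+ 2 <= (a + b) ^+ 2.
    by rewrite lerXn2r ?nnegrE ?addr_ge0 ?normc_ge0.
  apply: le_trans (ler_wpM2l (ltW k0') h2) _.
  rewrite -natr1 -subr_ge0.
  have -> : k%:R * (k%:R + 1) * a ^+ 2 + (k%:R + 1) * b ^+ 2 - k%:R * (a + b) ^+ 2
    = (k%:R * a - b) ^+ 2 by ring.
  exact: sqr_ge0.
rewrite -(ler_pM2l k0') mulr_sumr.
apply: le_trans (ler_sum _ (fun xi _ => tri xi)) _.
rewrite big_split /= -!mulr_sumr.
have h1 := XB _ yX; have h2 := IH _ zk.
have e1 : 0 <= k%:R * k.+1%:R :> R by rewrite mulr_ge0 ?ler0n.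
have e2 : 0 <= k.+1%:R :> R by rewrite ler0n.
apply: le_trans (lerD (ler_wpM2l e1 h1) (ler_wpM2l e2 h2)) _.
rewrite -natr1 le_eqVlt; apply/orP; left; apply/eqP; ring.
Qed.

Variables (n : nat) (w : 'I_n -> 'F_p).

Lemma weight_form_ge0 xi : 0 <= weight_form R w xi.
Proof. by apply: sumr_ge0 => i _; apply: phi_ge0. Qed.

Lemma weight_form_le xi : weight_form R w xi <= 2 * n%:R.
Proof.
apply: le_trans (ler_sum _ (fun i _ => phi_le2 R (w i * xi))) _.
by rewrite sumr_const card_ord mulr_natr.
Qed.

Lemma small_weight (beta rho0 : R) : 0 < rho0 ->
  rho0 * p%:R <= \sum_(xi | xi != 0) expR (- beta * weight_form R w xi) ->
  exists2 xi, xi != 0 & rho0 <= expR (- beta * weight_form R w xi).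
Proof.
move=> rho0_gt0 H.
have [/existsP[xi /andP[xi0 h]]|/existsPn N] := boolP [exists xi,
    (xi != 0) && (rho0 <= expR (- beta * weight_form R w xi))].
  by exists xi.
exfalso; move: H; rewrite leNgt => /negP[].
apply: le_lt_trans (_ : \sum_(xi : 'F_p | xi != 0) rho0 < _).
  apply: ler_sum => xi xi0; have := N xi; rewrite xi0 /= -ltNge; exact: ltW.
have -> : rho0 * p%:R = \sum_(xi : 'F_p) rho0.
  by rewrite sumr_const card_Fp // mulr_natr.
by rewrite [ltRHS](bigD1 0) //= ltrDr.
Qed.

(** If every level set were smaller, summing over the levels would give a geometric series of ratio
    $e^{-\beta/2}$ with total below [rho0 * p]. Half of the decay is thus spent on summability, and
    the other half remains as the gain in [m]. *)
Lemma level_set (beta rho0 : R) : 0 < beta -> 0 < rho0 ->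
  rho0 * p%:R <= \sum_(xi | xi != 0) expR (- beta * weight_form R w xi) ->
  exists (m : nat), exists2 S : {set 'F_p},
    (forall xi, xi \in S -> weight_form R w xi <= m.+1%:R) &
    (1 - expR (- (beta / 2))) * (rho0 * p%:R) * expR (beta / 2 * m%:R)
      <= #|S|%:R.
Proof.
move=> beta0 rho0_gt0 H.
pose S m := [set xi : 'F_p | weight_form R w xi < m.+1%:R].
have [[m hm]|N] := pselect (exists m,
    (1 - expR (- (beta / 2))) * (rho0 * p%:R) * expR (beta / 2 * m%:R)
      <= #|S m|%:R :> R).
  by exists m, (S m) => // xi; rewrite inE => /ltW.
exfalso; move: H; rewrite leNgt => /negP[].
pose M := (2 * n).+1; set x := expR (- (beta / 2)) in N.
set c := rho0 * p%:R in N *.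
have c0 : 0 < c by rewrite mulr_gt0 // ltr0n prime_gt0.
have x1 : x < 1 by rewrite expR_lt1; lra.
have x0 : 0 < x by apply: expR_gt0.
have layer xi : expR (- beta * weight_form R w xi) <=
    \sum_(m < M) (xi \in S m)%:R * expR (- beta * m%:R).
  have g0 := weight_form_ge0 xi; have gn := weight_form_le xi.
  have /andP[t1 t2] := trunc_itv g0.
  set t := Num.trunc _ in t1 t2.
  have tM : (t < M)%N.
    by rewrite ltnS -(ler_nat R) natrM; apply: le_trans gn.
  rewrite (bigD1 (Ordinal tM)) //= inE t2 mul1r.
  rewrite -[leLHS]addr0 lerD //.
    by rewrite ler_expR ler_wnM2l //; lra.
  by apply: sumr_ge0 => i _; rewrite mulr_ge0 ?ler0n ?expR_ge0.
apply: le_lt_trans (_ : \sum_xi \sum_(m < M) (xi \in S m)%:R * expR (- beta * m%:R) < _).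
  rewrite [leLHS]big_mkcond; apply: ler_sum => xi _.
  apply: le_trans (layer xi); by case: ifP; rewrite // expR_ge0.
rewrite exchange_big /=.
apply: le_lt_trans (_ : \sum_(m < M) (1 - x) * c * x ^+ m < _).
  apply: ler_sum => m _; rewrite -mulr_suml -natr_sum -big_mkcond /= sum1_card.
  have /negP := fun h => N (ex_intro _ (m : nat) h); rewrite -ltNge => h.
  have -> : x ^+ m = expR (beta / 2 * m%:R) * expR (- beta * m%:R).
    by rewrite /x -expRM_natr -expRD; congr expR; lra.
  by rewrite mulrA ler_wpM2r ?expR_ge0 // ltW.
rewrite -mulr_sumr [_ * c]mulrC -mulrA.
have -> : (1 - x) * \sum_(m < M) x ^+ m = 1 - x ^+ M.
  by rewrite -opprB mulNr -subrX1 opprB.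
by rewrite gtr_pMr // ltrBlDr ltrDl exprn_gt0.
Qed.

End Selection.

Lemma poly_le_expR (R : realType) (a : nat) (delta : R) : 0 < delta ->
  exists2 D : R, 0 < D & forall m : nat, m.+1%:R ^+ a <= D * expR (delta * m%:R).
Proof.
move=> delta0.
(* Chosen so that [t * (1 + delta * m / (a + 1))] is at least [m + 1]; raising to the power [a + 1],
   and not [a], keeps the division valid when [a = 0]. *)
pose t : R := 1 + a.+1%:R / delta.
have a0 : 0 < a.+1%:R :> R by rewrite ltr0n.
have t1 : 1 <= t by rewrite lerDl divr_ge0 // ltW.
have t0 : 0 < t by lra.
exists (t ^+ a.+1); first by rewrite exprn_gt0.
move=> m.
apply: le_trans (_ : m.+1%:R ^+ a.+1 <= _).
  by rewrite exprS ler_peMl ?exprn_ge0 ?ler0n // ler1n.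
have -> : expR (delta * m%:R) = expR (delta / a.+1%:R * m%:R) ^+ a.+1.
  by rewrite -expRM_natr; congr expR; field; rewrite gt_eqF.
rewrite -exprMn lerXn2r ?nnegrE ?mulr_ge0 ?ler0n ?expR_ge0 // ?(ltW t0) //.
apply: le_trans (ler_wpM2l (ltW t0) (expR_ge1Dx _)).
rewrite -natr1 mulrDr mulr1 addrC lerD // mulrA.
apply: ler_peMl; first exact: ler0n.
rewrite mulrDl mul1r mulrA divfK ?gt_eqF // divff ?gt_eqF //.
by rewrite lerDr divr_ge0 // ltW.
Qed.

(** * The two ranges of the prime *)

Lemma interval_gap (p : nat) (xi x : 'F_p) (L : nat) : prime p -> xi != 0 ->
  (`|centered (x * xi)%R| <= L)%N ->
  gap_set (symmetric_gap (fun _ : 'I_1 => xi^-1) (fun=> L)) x.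
Proof.
move=> pp xi0 hL.
have := @mem_symmetric_gap _ 1 (fun=> xi^-1) (fun=> L) (fun=> centered (x * xi)).
rewrite big_ord_recl big_ord0 addr0.
have -> : xi^-1 *~ centered (x * xi) = x.
  by rewrite -mulrzr centered_val // mulrC mulfK.
by apply.
Qed.

Lemma card_interval_gap (p : nat) (xi : 'F_p) (L : nat) :
  (#|gap_set (symmetric_gap (fun _ : 'I_1 => xi^-1) (fun=> L))| <= (2 * L).+1)%N.
Proof.
by apply: leq_trans (card_symmetric_gap _ _) _; rewrite big_ord_recl big_ord0 muln1.
Qed.

Section Cases.
Variables (R : realType) (beta C c1 : R).
Hypotheses (beta_gt0 : 0 < beta) (C_gt0 : 0 < C) (c1_gt0 : 0 < c1).

Definition concentrated (n p : nat) (w : 'I_n -> 'F_p) (rho0 : R) :=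
  c1 * n%:R `^ (- C) <= rho0 /\
  rho0 * p%:R <= \sum_(xi | xi != 0) expR (- beta * weight_form R w xi).

Lemma interval_case : exists2 K : R, 0 < K &
  forall (n p : nat) (w : 'I_n -> 'F_p) (rho0 : R) (n' : nat),
  (0 < n)%N -> prime p -> concentrated w rho0 -> (0 < n' <= n)%N ->
  exists2 W' : {set 'I_n}, #|W'| = (n - n')%N &
    exists2 Q : gap 'F_p 1, (forall i, i \in W' -> gap_set Q (w i)) &
      #|gap_set Q|%:R <= K * (1 + p%:R * Num.sqrt (ln n%:R / n'%:R)).
Proof.
have l2 : 0 < ln 2 :> R by rewrite ln_gt0 // ltr1n.
(* For [n >= 2] the constant [ln c1] is absorbed into a multiple of [ln n], using [ln 2 <= ln n]. *)
pose K1 : R := (C + `|ln c1| / ln 2) / beta.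
have K10 : 0 < K1.
  by rewrite divr_gt0 // ltr_pwDl // divr_ge0 // ltW.
exists (1 + Num.sqrt K1); first by rewrite ltr_pwDl ?sqrtr_ge0.
move=> n p w rho0 n' n0 pp [rlow rsum] /andP[n'0 n'n].
have p0 : 0 < p%:R :> R by rewrite ltr0n prime_gt0.
have n0' : 0 < n'%:R :> R by rewrite ltr0n.
(* For [n = 1] the logarithm vanishes and absorbs nothing, but then [n' = 1] and no component has to
   be covered. *)
have [n1|n1] := leqP n 1.
  have e : (n - n')%N = 0%N by move: n1 n'0; clear; lia.
  exists finset.set0; first by rewrite cards0 e.
  exists (symmetric_gap (fun _ : 'I_1 => (1 : 'F_p)^-1) (fun=> 0%N)).
    by move=> i; rewrite finset.inE.
  apply: le_trans (_ : 1 <= _).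
    by rewrite (_ : 1 = 1%:R) // ler_nat; apply: card_interval_gap.
  have s0 : 0 <= p%:R * Num.sqrt (ln n%:R / n'%:R) :> R.
    by rewrite mulr_ge0 ?sqrtr_ge0 // ltW.
  rewrite -[leLHS]mulr1; apply: ler_pM => //; first by rewrite lerDl sqrtr_ge0.
  by rewrite lerDl.
have nR : 1 < n%:R :> R by rewrite ltr1n.
have rho0_gt0 : 0 < rho0.
  by apply: lt_le_trans rlow; rewrite mulr_gt0 // powR_gt0 //; lra.
have [xi xi0 hxi] := small_weight pp rho0_gt0 rsum.
have gle : weight_form R w xi <= K1 * ln n%:R.
  have : ln (c1 * n%:R `^ (- C)) <= ln (expR (- beta * weight_form R w xi)).
    rewrite ler_ln ?posrE ?expR_gt0 ?(le_trans rlow) //.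
    by rewrite mulr_gt0 // powR_gt0 //; lra.
  rewrite expRK lnM ?posrE ?powR_gt0 //; last by lra.
  rewrite ln_powR => h.
  have ln2 : ln 2 <= ln n%:R :> R.
    by rewrite ler_ln ?posrE ?ltr0n // ler_nat.
  have h2 : `|ln c1| <= `|ln c1| / ln 2 * ln n%:R.
    by rewrite mulrAC ler_pdivlMr // ler_wpM2l.
  have h3 := ler_norm (- ln c1); rewrite normrN in h3.
  rewrite /K1 mulrAC ler_pdivlMr // mulrDl.
  lra.
have lnn : 0 < ln n%:R :> R by apply: ln_gt0.
have [W cW hW] := markov_select (mulr_gt0 K10 lnn) n'0
  (fun i => phi_ge0 R (w i * xi)) gle.
exists W => //.
pose b : R := p%:R / 2 * Num.sqrt (K1 * ln n%:R / n'%:R).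
have b0 : 0 <= b by rewrite mulr_ge0 ?sqrtr_ge0 // divr_ge0 // ltW.
exists (symmetric_gap (fun _ : 'I_1 => xi^-1) (fun=> Num.trunc b)).
  move=> i /hW h; apply: interval_gap => //.
  set c := `|_|%N.
  have cb : c%:R <= b.
    have := le_trans (phi_ge_centered R pp (w i * xi)) h.
    rewrite -/c => h2.
    have q0 : 0 <= K1 * ln n%:R / n'%:R by rewrite divr_ge0 // ltW // mulr_gt0.
    rewrite -(@ler_pXn2r _ 2) ?nnegrE ?ler0n // /b exprMn sqr_sqrtr //.
    have -> : c%:R ^+ 2 = (p%:R / 2) ^+ 2 * (4 * (c%:R / p%:R) ^+ 2) :> R.
      by field; rewrite gt_eqF.
    by rewrite ler_wpM2l ?sqr_ge0.
  rewrite -ltnS -(ltr_nat R); apply: le_lt_trans cb _; exact: truncnS_gt.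
apply: le_trans (_ : (2 * Num.trunc b).+1%:R <= _).
  by rewrite ler_nat; apply: card_interval_gap.
have /andP[tb _] := trunc_itv b0.
apply: le_trans (_ : 1 + 2 * b <= _).
  by rewrite -natr1 natrM addrC lerD2l ler_pM2l.
have -> : 2 * b = Num.sqrt K1 * (p%:R * Num.sqrt (ln n%:R / n'%:R)).
  rewrite /b; have -> : Num.sqrt (K1 * ln n%:R / n'%:R) =
      Num.sqrt K1 * Num.sqrt (ln n%:R / n'%:R).
    by rewrite -mulrA sqrtrM // ltW.
  by field.
set u := p%:R * _.
have u0 : 0 <= u by rewrite mulr_ge0 ?sqrtr_ge0 // ltW.
have s0 := sqrtr_ge0 K1.
nra.
Qed.

Variable eps : R.
Hypothesis eps_gt0 : 0 < eps.

Let a := (Num.trunc (2 * C / eps)).+1.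

(** This is where [eps] matters: since [n'] is at least a fixed power of [n], bounds polynomial in
    [n] become polynomial in [n'], hence in the scale of the sumset. *)
Lemma powR_le_subpower (n n' : nat) : (0 < n)%N ->
  n%:R `^ (eps / 2) <= n'%:R :> R ->
  (0 < n')%N /\ n%:R `^ C <= n'%:R ^+ a :> R.
Proof.
move=> n0 h.
have n1 : 1 <= n%:R :> R by rewrite ler1n.
have n'0 : 0 < n'%:R :> R by apply: lt_le_trans h; rewrite powR_gt0 // ltr0n.
have n'0' : (0 < n')%N by rewrite -(ltr_nat R).
split=> //.
have e : C = (eps / 2) * (2 * C / eps) by field; rewrite gt_eqF.
have k0 : 0 <= 2 * C / eps by rewrite divr_ge0 ?mulr_ge0 // ltW.
rewrite {1}e powRrM; apply: le_trans (_ : n'%:R `^ (2 * C / eps) <= _).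
  by apply: ge0_ler_powR => //; rewrite nnegrE ?powR_ge0 ?ltW.
rewrite -powR_mulrn; last by rewrite ltW.
apply: ler_powR; first by rewrite ler1n.
by rewrite ltW // truncnS_gt.
Qed.

End Cases.

Definition gap_cover (R : realType) (n p : nat) (w : 'I_n -> 'F_p) (rho0 : R) (n' : nat)
    (K : R) :=
  exists2 W' : {set 'I_n}, #|W'| = (n - n')%N &
    exists r : nat, (0 < r)%N /\ r%:R <= K /\
    exists Q : gap 'F_p r,
      [/\ gap_proper Q, gap_symmetric Q,
          (forall i, i \in W' -> gap_set Q (w i)) &
          #|gap_set Q|%:R <= K * (1 + rho0^-1 / n'%:R `^ (r%:R / 2))].

(** For bounded [n], the set of 0 and all [w i] and [- w i] has bounded size, so one fixed scale
    already satisfies the growth hypothesis, and the resulting progression has bounded size. *)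
Lemma bounded_case (R : realType) (N : nat) : exists2 K : R, 0 < K &
  forall (n p : nat) (w : 'I_n -> 'F_p) (rho0 : R) (n' : nat),
  (n <= N)%N -> prime p -> 0 <= rho0 -> K <= p%:R -> gap_cover w rho0 n' K.
Proof.
(* From $(2^s+1)^{2N+1}\le 2^{(s+1)(2N+1)}\le 2^{gs}$, valid since $s\ge1$. *)
pose g := (2 * (2 * N + 1))%N.
have [s0 [K1 [K10 inv]]] := inverse_sumset R g.
pose s := s0.+1.
pose K : nat := (K1 * (1 + 2 ^ (g * s)) + g.+1)%N.
exists K%:R; first by rewrite ltr0n /K addn_gt0 orbT.
move=> n p w rho0 n' nN pp rho0_ge0; rewrite ler_nat => Kp.
pose X : {set 'F_p} := finset.setU (finset.set1 0)
  (finset.setU (w @: 'I_n) ((fun i => - w i) @: 'I_n)).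
have X0 : 0 \in X by rewrite !finset.inE eqxx.
have Xw i : w i \in X by rewrite !finset.inE imset_f ?orbT.
have Xs : symmetric_set X.
  move=> x; rewrite !finset.inE => /orP[/eqP ->|/orP[/imsetP[i _ ->]|/imsetP[i _ ->]]].
  - by rewrite oppr0 eqxx.
  - by rewrite (imset_f (fun i => - w i)) ?orbT.
  - by rewrite opprK imset_f ?orbT.
have cX : (#|X| <= 2 * N + 1)%N.
  have h1 := leq_imset_card w 'I_n; have h2 := leq_imset_card (fun i => - w i) 'I_n.
  rewrite card_ord in h1 h2.
  apply: leq_trans (leq_card_setU _ _) _; rewrite cards1.
  rewrite add1n addn1 ltnS; apply: leq_trans (leq_card_setU _ _) _.
  by apply: leq_trans (leq_add h1 h2) _; lia.
have grow : (#|nsum (2 ^ s) X| <= 2 ^ (g * s))%N.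
  apply: leq_trans (card_nsum_le _ _) _.
  apply: (@leq_trans ((2 ^ (s.+1)) ^ (2 * N + 1))).
    apply: (@leq_trans ((2 ^ s).+1 ^ (2 * N + 1))); first by rewrite leq_pexp2l.
    rewrite leq_exp2r ?addn1 // expnS.
    by have := expn_gt0 2 s; lia.
  rewrite -expnM leq_exp2l // /g mulnAC leq_mul2r; apply/orP; right.
  by rewrite /s; lia.
have [||r [Q [/andP[r0 rg] Qp Qs Qw Qc]]] := inv p X s pp X0 Xs _ grow.
- exact: leqnSn.
- apply: leq_trans Kp; apply: leq_trans (_ : K1 * 2 ^ (g * s) <= _)%N.
    by rewrite leq_mul2l grow orbT.
  by rewrite /K; lia.
have [W' cW' _] := @subset_of_card _ (finset.setTfor 'I_n) (n - n')
  (leq_trans (leq_subr _ _) (eq_leq (esym (etrans (cardsT _) (card_ord n))))).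
exists W' => //; exists r; split=> //; split; first by rewrite ler_nat /K; lia.
exists Q; split=> //; first by move=> i _; apply: Qw.
apply: le_trans (_ : K%:R <= _).
  rewrite ler_nat /K; apply: (@leq_trans (K1 * (1 + 2 ^ (g * s)))); last exact: leq_addr.
  have e : (0 < 2 ^ (s * r))%N by rewrite expn_gt0.
  rewrite -(leq_pmul2r e); apply: leq_trans Qc _.
  rewrite -mulnA leq_mul2l; apply/orP; right.
  rewrite mulnDl mul1n leq_add2l; apply: leq_trans grow _.
  by rewrite leq_pmulr.
rewrite -[leLHS]mulr1 ler_wpM2l ?ler0n // lerDl.
by rewrite divr_ge0 ?invr_ge0 ?powR_ge0.
Qed.

Lemma gap_cover_mono (R : realType) (n p : nat) (w : 'I_n -> 'F_p) (rho0 : R)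
    (n' : nat) (K K' : R) : 0 <= rho0 -> K <= K' ->
  gap_cover w rho0 n' K -> gap_cover w rho0 n' K'.
Proof.
move=> rho0_ge0 KK' [W' cW' [r [r0 [rK [Q [Q1 Q2 Q3 Q4]]]]]].
exists W' => //; exists r; split=> //; split; first exact: le_trans KK'.
exists Q; split=> //; apply: le_trans Q4 _; rewrite ler_wpM2r //.
by rewrite addr_ge0 // divr_ge0 ?invr_ge0 ?powR_ge0.
Qed.

(** Applied with [M = 2 * m.+1]: then [4 ^ s * (m + 1) / n'] is at most 1/2, which is the threshold
    of [card_small_phi_sum] for the sumset at scale [2 ^ s]. *)
Lemma dyadic_scale (s0 M n' : nat) : (0 < M)%N -> (4 ^ s0 * M <= n')%N ->
  exists s, [/\ (s0 <= s)%N, (4 ^ s * M <= n')%N & (n' < 4 ^ s.+1 * M)%N].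
Proof.
move=> M0 h; have q0 : (4 ^ s0 <= n' %/ M)%N by rewrite leq_divRL.
have qpos : (0 < n' %/ M)%N by apply: leq_trans q0; rewrite expn_gt0.
have l1 := trunc_logP (isT : (1 < 4)%N) qpos.
have l2 := trunc_log_ltn (n' %/ M) (isT : (1 < 4)%N).
exists (trunc_log 4 (n' %/ M)); split.
- by rewrite -ltnS -(ltn_exp2l _ _ (isT : (1 < 4)%N)); apply: leq_ltn_trans l2.
- by rewrite -leq_divRL.
- by rewrite -ltn_divLR.
Qed.

Lemma powR_scale (R : realType) (s r : nat) :
  ((4 ^ s)%:R : R) `^ (r%:R / 2) = (2 ^ (s * r))%:R.
Proof.
have -> : ((4 ^ s)%:R : R) = (2 ^ s)%:R `^ 2%:R.
  by rewrite powR_mulrn ?ler0n // -natrX -expnM mulnC expnM.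
rewrite -powRrM (_ : 2%:R * (r%:R / 2) = r%:R :> R); last by field.
by rewrite powR_mulrn ?ler0n // -natrX -expnM.
Qed.

(** If [n'] is at most a multiple of [m + 1], then $e^{\beta m/2}\lesssim n^C\le
    n'^a\lesssim(m+1)^a\lesssim e^{\beta m/4}$. This bounds [m], then [n'], then [n]. *)
Lemma bounded_level (R : realType) (beta C eps c : R) (s0 : nat) :
  0 < beta -> 0 < C -> 0 < eps -> 0 < c -> exists N : nat,
  forall n n' m : nat, (0 < n)%N -> n%:R `^ (eps / 2) <= n'%:R :> R ->
  c * expR (beta / 2 * m%:R) <= n%:R `^ C -> (n' < 4 ^ s0 * (2 * m.+1))%N ->
  (n <= N)%N.
Proof.
move=> beta_gt0 C_gt0 eps_gt0 c0; pose a := (Num.trunc (2 * C / eps)).+1.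
have b4 : 0 < beta / 4 by rewrite divr_gt0.
have [D D0 hD] := poly_le_expR a b4.
pose L : R := (4 ^ s0 * 2)%:R ^+ a * D / c.
pose m0 := Num.trunc (4 * L / beta).
pose N1 : R := (4 ^ s0 * (2 * m0.+1))%:R ^+ a.
exists (Num.trunc (N1 `^ C^-1)) => n n' m n0 hn hm n'lt.
have [n'0 hC] := powR_le_subpower C_gt0 eps_gt0 n0 hn; rewrite -/a in hC.
set E := expR (beta / 4 * m%:R).
have E0 : 0 < E by apply: expR_gt0.
have EE : expR (beta / 2 * m%:R) = E * E.
  by rewrite /E -expRD; congr expR; lra.
have n'a : n'%:R ^+ a <= (4 ^ s0 * 2)%:R ^+ a * (m.+1%:R ^+ a) :> R.
  rewrite -exprMn -natrM -!natrX ler_nat leq_exp2r //.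
  by rewrite -mulnA ltnW.
have EL : E <= L.
  have h1 : (4 ^ s0 * 2)%:R ^+ a * (m.+1%:R ^+ a) <= (4 ^ s0 * 2)%:R ^+ a * (D * E) :> R.
    by rewrite ler_wpM2l ?exprn_ge0 ?ler0n.
  have h2 : c * (E * E) <= (4 ^ s0 * 2)%:R ^+ a * (D * E).
    by rewrite -EE; apply: le_trans hm (le_trans hC (le_trans n'a h1)).
  rewrite /L ler_pdivlMr // -(ler_pM2r E0).
  by move: h2; rewrite mulrC !mulrA mulrAC.
have mm0 : (m <= m0)%N.
  have h : m%:R <= 4 * L / beta.
    rewrite ler_pdivlMr //.
    have := le_trans (expR_ge1Dx _) EL; lra.
  rewrite -ltnS -(ltr_nat R); apply: le_lt_trans h _; exact: truncnS_gt.
have hN1 : n%:R `^ C <= N1.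
  apply: le_trans hC _; rewrite /N1 -!natrX ler_nat leq_exp2r //.
  by apply: leq_trans (ltnW n'lt) _; rewrite !leq_mul2l ltnS mm0 !orbT.
have hn1 : n%:R <= N1 `^ C^-1.
  have -> : (n%:R : R) = (n%:R `^ C) `^ C^-1.
    by rewrite -powRrM divff ?gt_eqF // powRr1 // ler0n.
  apply: ge0_ler_powR => //; rewrite ?nnegrE ?invr_ge0 ?ltW ?powR_gt0 ?ltr0n //.
  by apply: lt_le_trans hN1; rewrite powR_gt0 // ltr0n.
rewrite -ltnS -(ltr_nat R); apply: le_lt_trans hn1 _; exact: truncnS_gt.
Qed.

Lemma large_prime_case (R : realType) (beta C c1 eps : R) :
  0 < beta -> 0 < C -> 0 < c1 -> 0 < eps -> exists2 K : R, 0 < K &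
  forall (n p : nat) (w : 'I_n -> 'F_p) (rho0 : R) (n' : nat),
  (0 < n)%N -> prime p -> concentrated beta C c1 w rho0 ->
  n%:R `^ (eps / 2) <= n'%:R -> (n' <= n)%N -> K * n%:R `^ C <= p%:R ->
  gap_cover w rho0 n' K.
Proof.
move=> beta_gt0 C_gt0 c1_gt0 eps_gt0; pose a := (Num.trunc (2 * C / eps)).+1.
pose c : R := 1 - expR (- (beta / 2)).
have b2 : 0 < beta / 2 by rewrite divr_gt0.
have c0 : 0 < c by rewrite subr_gt0 expR_lt1 oppr_lt0.
(* The sumset at scale [2 ^ s] has at most [C3 * 4 ^ (a * s)] elements, and [C3 <= 2 ^ s] once
   [s >= s0]; this accounts for the exponents [2 * a] and 1. *)
pose g := (2 * a + 1)%N.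
have [s1 [K1 [K10 inv]]] := inverse_sumset R g.
have [D2 D20 hD2] := poly_le_expR a b2.
have [D3 D30 hD3] := poly_le_expR g.+1 b2.
pose T : R := 4 / (c * c1).
have T0 : 0 < T by rewrite divr_gt0 // mulr_gt0.
pose C3 : R := T * 8 ^+ a * D2.
pose s0 := (s1 + (Num.trunc C3).+1)%N.
have [N hN] := bounded_level s0 beta_gt0 C_gt0 eps_gt0 (mulr_gt0 c0 c1_gt0).
have [Kb Kb0 hKb] := bounded_case R N.
pose C7 : R := 4 / c * 8 ^+ g.+1 * D3.
have C70 : 0 < C7.
  by rewrite /C7 mulr_gt0 // mulr_gt0 ?exprn_gt0 // divr_gt0.
have K1R : 0 < K1%:R :> R by rewrite ltr0n.
pose K : R := Kb + K1%:R * T + g.+1%:R + K1%:R * (1 + C7).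
have k1 : 0 < K1%:R * T by rewrite mulr_gt0.
have k2 : 0 < K1%:R * (1 + C7) by rewrite mulr_gt0 // addr_gt0.
have k3 : 0 <= g.+1%:R :> R by rewrite ler0n.
have KbK : Kb <= K by clear -k1 k2 k3; rewrite /K; lra.
have TK : K1%:R * T <= K by clear -k1 k2 k3 Kb0; rewrite /K; lra.
have gK : g.+1%:R <= K by clear -k1 k2 k3 Kb0; rewrite /K; lra.
have CK : K1%:R * (1 + C7) <= K by clear -k1 k2 k3 Kb0; rewrite /K; lra.
have K0 : 0 < K := lt_le_trans Kb0 KbK.
clearbody K.
exists K => //.
move=> n p w rho0 n' n0 pp conc hn n'n hp.
have [n'0 hC] := powR_le_subpower C_gt0 eps_gt0 n0 hn; rewrite -/a in hC.
have [rlow rsum] := conc.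
have p0 : 0 < p%:R :> R by rewrite ltr0n prime_gt0.
have nR : 0 < n%:R :> R by rewrite ltr0n.
have nC : 0 < n%:R `^ C by apply: powR_gt0.
have nC1 : 1 <= n%:R `^ C.
  have n1 : 1 <= n%:R :> R by rewrite ler1n.
  by have := ler_powR n1 (ltW C_gt0); rewrite powRr0.
have rho0_gt0 : 0 < rho0 by apply: lt_le_trans rlow; rewrite mulr_gt0 // powR_gt0.
have rhoC : c1 <= rho0 * n%:R `^ C.
  by move: rlow; rewrite powRN ler_pdivrMr.
have [m [S Sle Sge]] := level_set pp beta_gt0 rho0_gt0 rsum.
rewrite -/c in Sge; set E := expR _ in Sge.
have E1 : 1 <= E.
  apply: le_trans (expR_ge1Dx _); rewrite lerDl.
  by apply: mulr_ge0; [exact: ltW|exact: ler0n].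
have E0 : 0 < E := lt_le_trans ltr01 E1.
have Sp : #|S|%:R <= p%:R :> R.
  by rewrite ler_nat; apply: leq_trans (max_card _) _; rewrite card_Fp.
have S0 : 0 < #|S|%:R :> R by apply: lt_le_trans Sge; rewrite !mulr_gt0.
(* If no admissible scale fits under [n'], then [n] is bounded and [bounded_case] applies. *)
have [n'lt|n'ge] := ltnP n' (4 ^ s0 * (2 * m.+1)).
  apply: (@gap_cover_mono _ _ _ _ _ _ Kb) => //; first exact: ltW.
  apply: hKb => //; last 2 first.
  - exact: ltW.
  - by apply: le_trans (le_trans KbK _) hp; apply: ler_peMr => //; exact: ltW.
  apply: (hN n n' m) => //.
  have h1 : c * rho0 * E <= 1.
    rewrite -(ler_pM2r p0) mul1r; apply: le_trans Sp; apply: le_trans Sge.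
    by rewrite le_eqVlt; apply/orP; left; apply/eqP; ring.
  have h2 : (c * E) * c1 <= (c * E) * (rho0 * n%:R `^ C).
    by rewrite ler_pM2l // mulr_gt0.
  have := ler_wpM2r (ltW nC) h1; rewrite -/E; move: h2; clear; lra.
have [s [s0s sM1 sM2]] := dyadic_scale (isT : (0 < 2 * m.+1)%N) n'ge.
pose B : R := m.+1%:R * #|S|%:R.
have B0 : 0 < B by rewrite mulr_gt0 // ltr0n.
have [W' cW' hW'] : exists2 W' : {set 'I_n}, #|W'| = (n - n')%N &
    forall i, i \in W' -> \sum_(xi in S) phi R (w i * xi) <= B / n'%:R.
  apply: markov_select => //.
    by move=> i; apply: sumr_ge0 => xi _; apply: phi_ge0.
  rewrite exchange_big /= /B mulr_natr -sumr_const; exact: ler_sum.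
pose X : {set 'F_p} :=
  finset.finset (fun x => \sum_(xi in S) phi R (x * xi) <= B / n'%:R).
have XP x : (x \in X) = (\sum_(xi in S) phi R (x * xi) <= B / n'%:R).
  by rewrite finset.inE.
have n'R : 0 < n'%:R :> R by rewrite ltr0n.
have X0 : 0 \in X.
  rewrite XP big1 ?divr_ge0 ?ltW // => xi _; by rewrite mul0r phi0.
have Xs : symmetric_set X.
  move=> x; rewrite !XP => h; apply: le_trans h.
  by apply: ler_sum => xi _; rewrite mulNr phiN.
have NS : (#|nsum (2 ^ s) X| * #|S| <= 4 * p)%N.
  apply: (@card_small_phi_sum R p pp) => x xX.
  apply: le_trans (_ : (2 ^ s)%:R ^+ 2 * (B / n'%:R) <= _).
    by apply: phi_sum_nsum xX => // y; rewrite XP.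
  rewrite mulrA ler_pdivrMr // /B.
  have : (4 ^ s * (2 * m.+1))%:R <= n'%:R :> R by rewrite ler_nat.
  rewrite !natrM -(natrX _ (2 ^ s)) -expnM [(s * 2)%N]mulnC expnM => h.
  have := ler_wpM2r (ltW S0) h; clear; lra.
set N0 := #|nsum (2 ^ s) X| in NS.
have N0E : N0%:R * c * rho0 * E <= 4.
  have h : N0%:R * #|S|%:R <= 4 * p%:R :> R by rewrite -!natrM ler_nat.
  rewrite -(ler_pM2r p0); apply: le_trans h.
  apply: le_trans (ler_wpM2l (ler0n R N0) Sge).
  by rewrite le_eqVlt; apply/orP; left; apply/eqP; ring.
have N0T : N0%:R * E <= T * n%:R `^ C.
  rewrite /T mulrAC ler_pdivlMr ?mulr_gt0 //.
  have h1 : N0%:R * E * c * c1 <= N0%:R * E * c * (rho0 * n%:R `^ C).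
    by rewrite ler_wpM2l // !mulr_ge0 ?ler0n // ltW.
  have := ler_wpM2r (ltW nC) N0E; move: h1; clear; lra.
have N0T1 : N0%:R <= T * n%:R `^ C.
  by apply: le_trans N0T; rewrite ler_peMr ?ler0n.
have n'8 : n'%:R <= (4 ^ s)%:R * (8 * m.+1%:R) :> R.
  rewrite -!natrM ler_nat; apply: leq_trans (ltnW sM2) _.
  by rewrite expnS; apply: eq_leq; ring.
have grow : (N0 <= 2 ^ (g * s))%N.
  have h1 : N0%:R * E <= T * ((4 ^ s)%:R ^+ a * (8 ^+ a * (D2 * E))).
    apply: le_trans N0T _; rewrite ler_pM2l //; apply: le_trans hC _.
    apply: le_trans (_ : ((4 ^ s)%:R * (8 * m.+1%:R)) ^+ a <= _).
      by rewrite lerXn2r ?nnegrE ?mulr_ge0 ?ler0n.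
    by rewrite !exprMn !ler_wpM2l ?exprn_ge0 ?ler0n.
  have h2 : N0%:R <= C3 * (4 ^ s)%:R ^+ a.
    rewrite -(ler_pM2r E0); apply: le_trans h1 _.
    by rewrite /C3 le_eqVlt; apply/orP; left; apply/eqP; ring.
  have h3 : C3 <= (2 ^ s)%:R.
    apply: ltW; apply: lt_le_trans (truncnS_gt _) _; rewrite ler_nat.
    apply: ltnW; apply: leq_ltn_trans (_ : s < _)%N; last exact: ltn_expl.
    by apply: leq_trans s0s; rewrite leq_addl.
  rewrite -(ler_nat R); apply: le_trans h2 _.
  have -> : (2 ^ (g * s) = 2 ^ s * (4 ^ s) ^ a)%N.
    by rewrite /g -!expnM -(expnM 2 2) -expnD; congr (2 ^ _)%N; ring.
  by rewrite natrM (natrX _ (4 ^ s)) ler_wpM2r ?exprn_ge0 ?ler0n.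
have pN0 : (K1 * N0 <= p)%N.
  rewrite -(ler_nat R) natrM; apply: le_trans hp.
  apply: le_trans (ler_wpM2l (ltW K1R) N0T1) _.
  by rewrite mulrA ler_wpM2r ?(ltW nC).
have s1s : (s1 <= s)%N by apply: leq_trans s0s; rewrite leq_addr.
have [r [Q [/andP[r0 rg] Qp Qs Qw Qc]]] := inv p X s pp X0 Xs s1s grow pN0.
rewrite -/N0 in Qc.
exists W' => //; exists r; split=> //; split.
  by apply: le_trans gK; rewrite ler_nat.
exists Q; split=> //; first by move=> i iW; apply: Qw; rewrite XP; apply: hW'.
pose P : R := (2 ^ (s * r))%:R.
have P0 : 0 < P by rewrite ltr0n expn_gt0.
have np : 0 < n'%:R `^ (r%:R / 2) :> R by apply: powR_gt0.
have n'P : n'%:R `^ (r%:R / 2) <= P * (8 ^+ g.+1 * (D3 * E)).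
  apply: le_trans (_ : ((4 ^ s)%:R * (8 * m.+1%:R)) `^ (r%:R / 2) <= _).
    by apply: ge0_ler_powR => //; rewrite ?nnegrE ?divr_ge0 ?mulr_ge0 ?ler0n.
  rewrite powRM ?mulr_ge0 ?ler0n // powR_scale ler_pM2l //.
  apply: le_trans (_ : (8 * m.+1%:R) ^+ g.+1 <= _); last first.
    by rewrite exprMn ler_wpM2l ?exprn_ge0 ?ler0n.
  rewrite -powR_mulrn ?mulr_ge0 ?ler0n //; apply: ler_powR.
    by rewrite -natrM ler1n.
  have : r%:R <= g.+1%:R :> R by rewrite ler_nat.
  by have := ler0n R r; clear; lra.
(* The factor [E] that bounds the power of [m + 1] in [n'P] is the one already gained in [N0E], so
   [m] disappears from the estimate. *)
have N0P : N0%:R * n'%:R `^ (r%:R / 2) <= P * (C7 / rho0).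
  apply: le_trans (ler_wpM2l (ler0n R N0) n'P) _.
  rewrite mulrCA ler_pM2l // ler_pdivlMr // /C7.
  have -> : 4 / c * 8 ^+ g.+1 * D3 = 4 * (8 ^+ g.+1 * D3 / c) by field; rewrite gt_eqF.
  have -> : N0%:R * (8 ^+ g.+1 * (D3 * E)) * rho0 =
      N0%:R * c * rho0 * E * (8 ^+ g.+1 * D3 / c).
    by field; rewrite gt_eqF.
  have w0 : 0 <= 8 ^+ g.+1 * D3 / c.
    by apply: divr_ge0; [apply: mulr_ge0; [exact: exprn_ge0|exact: ltW]|exact: ltW].
  exact: (ler_wpM2r w0 N0E).
have QP : #|gap_set Q|%:R <= K1%:R * (1 + N0%:R / P) :> R.
  rewrite -(ler_pM2r P0) -mulrA mulrDl mul1r divfK ?gt_eqF //.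
  by rewrite -natrM -natrD -natrM ler_nat.
apply: le_trans QP _.
set u := rho0^-1 / _.
have u0 : 0 < u by rewrite divr_gt0 // invr_gt0.
have h1 : N0%:R / P <= C7 * u.
  rewrite -ler_pdivlMr // in N0P; rewrite ler_pdivrMr //.
  apply: le_trans N0P _; rewrite /u le_eqVlt; apply/orP; left; apply/eqP; ring.
apply: le_trans (_ : K1%:R * (1 + C7) * (1 + u) <= _).
  rewrite -mulrA ler_pM2l //; move: h1 u0 C70; clear; nra.
by rewrite ler_wpM2r // addr_ge0 // ltW.
Qed.

Local Open Scope classical_set_scope.
Local Open Scope ring_scope.

Theorem theorem3p1 (R : realType) (eps C alpha : R)
    (heps : 0 < eps < 1) (hC : 0 < C) (halpha : 0 < alpha)
    (c1 c2 : R) (hc1 : 0 < c1) (hc2 : 0 < c2) :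
  exists2 K : R, 0 < K &
  forall (n p : nat), (0 < n)%N -> prime p -> odd p ->
  forall (d0 : measure_display) (T0 : measurableType d0)
    (P0 : probability T0 R) (mu : {RV P0 >-> 'F_p}),
  alpha_balanced alpha mu ->
  forall (d : measure_display) (T : measurableType d)
    (P : probability T R) (mus : 'I_n -> {RV P >-> 'F_p}),
  iid_copies mus mu ->
  forall w : 'I_n -> 'F_p,
  c1 * n%:R `^ (- C) <= rho mus w <= c2 * n%:R `^ (- C) ->
  forall n' : nat, n%:R `^ (eps / 2) <= n'%:R :> R -> (n' <= n)%N ->
  exists2 W' : {set 'I_n}, #|W'| = (n - n')%N &
    (p%:R <= K * n%:R `^ C /\
     exists2 Q : gap 'F_p 1,
       (forall i, i \in W' -> gap_set Q (w i)) &
       #|gap_set Q|%:R <= K * (1 + p%:R * Num.sqrt (ln n%:R / n'%:R)))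
    \/
    (n%:R `^ C <= K * p%:R /\
     exists r : nat, (0 < r)%N /\ r%:R <= K /\
     exists Q : gap 'F_p r,
       [/\ gap_proper Q, gap_symmetric Q,
           (forall i, i \in W' -> gap_set Q (w i)) &
           #|gap_set Q|%:R <=
             K * (1 + (rho mus w)^-1 / n'%:R `^ (r%:R / 2))]).
Proof.
case/andP: heps => eps0 _.
have beta0 : 0 < alpha / 2 by rewrite divr_gt0.
have [Ka Ka0 interval] := interval_case beta0 hC hc1.
have [Kb Kb0 large] := large_prime_case beta0 hC hc1 eps0.
(* The summand 1 makes [1 <= K], which turns $Kn^C<p$ into $n^C\le Kp$ in the second alternative. *)
pose K := Ka + Kb + 1.
exists K; first by rewrite /K; lra.
move=> n p n0 pp podd d0 T0 P0 mu bal d T P mus iid w /andP[rlow _] n' hn n'n.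
have [n'0 _] := powR_le_subpower hC eps0 n0 hn.
have p0 : 0 < p%:R :> R by rewrite ltr0n prime_gt0.
have nC : 0 < n%:R `^ C by rewrite powR_gt0 // ltr0n.
have conc : concentrated (alpha / 2) C c1 w (rho mus w).
  by split=> //; have := rho_le pp halpha bal iid w; rewrite ler_pdivlMl // mulrC.
have rho0 : 0 <= rho mus w.
  by apply: le_trans rlow; rewrite mulr_ge0 ?powR_ge0 // ltW.
(* The interval argument puts no condition on [p]; the threshold is dictated by the large-prime
   argument. *)
have [pn|np] := leP p%:R (K * n%:R `^ C).
  have [|W' cW' [Q QW Qc]] := interval n p w (rho mus w) n' n0 pp conc.
    by rewrite n'0 n'n.
  exists W' => //; left; split=> //; exists Q => //.
  apply: le_trans Qc _; apply: ler_wpM2r; last by rewrite /K; lra.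
  by rewrite addr_ge0 // mulr_ge0 ?sqrtr_ge0 // ltW.
have hp : Kb * n%:R `^ C <= p%:R.
  apply: le_trans (ltW np); rewrite ler_wpM2r ?(ltW nC) // /K; lra.
have cov := large n p w (rho mus w) n' n0 pp conc hn n'n hp.
have KbK : Kb <= K by rewrite /K; lra.
have [W' cW' cover] := gap_cover_mono rho0 KbK cov.
exists W' => //; right; split=> //.
have K1 : 1 <= K by rewrite /K; lra.
apply: le_trans (_ : K * n%:R `^ C <= _); first by rewrite ler_peMl ?(ltW nC).
apply: le_trans (ltW np) _; by rewrite ler_peMl // ltW.
Qed.
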